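(* Let $\mathcal F$ be a subset of a $\delta_A$-class of non-algebraic so-pairs over $A$. Let $\mathcal F(\mathfrak C)$ be the set of realizations of all types $p$ appearing in pairs $(p,<_p)\in\mathcal F$, and $\mathcal D_{\mathcal F}=\{(x,y)\in\mathcal F(\mathfrak C)^2:x\mathop{\not\downarrow}_A y\}$. Then there is an $A$-invariant linear order $<^{\mathcal F}$ on $\mathcal F(\mathfrak C)$ such that: (i) $(\mathcal F(\mathfrak C),\triangleleft^{\mathcal F})$ is a strict partial order and $(\mathcal F(\mathfrak C),<^{\mathcal F})$ is a linear extension of it; (ii) $\mathcal D_{\mathcal F}$ and the $\triangleleft^{\mathcal F}$-incomparability relation coincide and are a $<^{\mathcal F}$-convex equivalence relation on $\mathcal F(\mathfrak C)$; the quotient $(\mathcal F(\mathfrak C)/\mathcal D_{\mathcal F},<^{\mathcal F})$ is a dense linear order; (iii) for each $p\in S(A)$ appearing in $\mathcal F$, the order $<_p=(<^{\mathcal F})\restriction p(\mathfrak C)$ is relatively $A$-definable, the pair $\mathbf p=(p,<_p)$ is directly nonorthogonal to the pairs from $\mathcal F$, and $(p(\mathfrak C),\triangleleft^{\mathbf p},<_p,\mathcal D_p)$ is a substructure of $(\mathcal F(\mathfrak C),\triangleleft^{\mathcal F},<^{\mathcal F},\mathcal D_{\mathcal F})$, where $\mathcal D_p=\{(x,y)\in p(\mathfrak C)^2: x\mathop{\not\downarrow}_A y\}$. Moreover, if $(\mathbf p_i=(p_i,<_i): i\in I)$ is a family of pairs from $\mathcal F$ with the types $p_i$ pairwise distinct,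 then $<^{\mathcal F}$ can be chosen to extend each $<_i$, $i\in I$.
   Context: $T$ complete (possibly multi-sorted), monster $\mathfrak C$, $A$ small. $a\mathop{\downarrow}_A B$: $\operatorname{tp}(a/AB)$ does not fork over $A$. $\mathbf p=(p,<_p)$, with $p\in S(A)$ and $<_p$ a linear order on $p(\mathfrak C)$ that is the trace of an $A$-definable relation, is an so-pair over $A$ if for every relatively definable (any parameters) $X\subseteq p(\mathfrak C)$ exactly one of $X$, $p(\mathfrak C)\setminus X$ contains a nonempty initial segment (left-eventual) and exactly one contains a nonempty final segment (right-eventual). $\mathbf p_r$ ($\mathbf p_l$) is the complete global type of all formulas whose trace on $p(\mathfrak C)$ is right- (left-) eventual. For a small set $B$ and $a\models p$: $a$ is right (left) $\mathbf p$-generic over $B$ if $a$ realizes the restriction of $\mathbf p_r$ ($\mathbf p_l$) to $A\cup B$; write $B\triangleleft^{\mathbf p}a$ for right genericity. $p\perp^w q$ means $p(x)\cup q(y)$ determines a complete type over $A$. For so-pairs $\mathbf p,\mathbf q$ over $A$ with $p\not\perp^w q$, they are directly nonorthogonal, $\delta_A(\mathbf p,\mathbf q)$, if for all $a\models p,b\models q$: ($a$ left $\mathbf p$-generic over $b$ iff $b$ right $\mathbf q$-generic over $a$) and ($a$ right $\mathbf p$-generic over $b$ iff $b$ left $\mathbf q$-generic over $a$); $\delta_A$ is an equivalence relation on so-pairs over $A$. For $a\in\mathcal F(\mathfrak C)$ and small $B$, $B\triangleleft^{\mathcal F}a$ means $B\triangleleft^{\mathbf p}a$ for some pair $\mathbf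 p=(p,<_p)\in\mathcal F$ with $a\models p$ (equivalently for all such pairs). *)

(* Defs.v *)
From mathcomp Require Import all_boot.
From mathcomp Require Import boolp classical_sets functions cardinality.

Set Implicit Arguments.
Unset Strict Implicit.
Unset Printing Implicit Defensive.

Local Open Scope classical_set_scope.
Local Open Scope card_scope.

Record signature := Signature {
  srt : Type;
  fsym : Type;
  far : fsym -> nat;
  fdom : forall f, 'I_(far f) -> srt;
  fcod : fsym -> srt;
  rsym : Type;
  rar : rsym -> nat;
  rdom : forall r, 'I_(rar r) -> srt
}.

(* Contexts are arbitrary sorted families of variables. They are used for    *)
(* finite tuples of free variables, for parameters (each parameter is a free *)
(* variable, interpreted by itself), and for small tuples.                   *)
Record ctx (L : signature) := Ctx { cvar : Type; csort : cvar -> srt L }.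

Record fctx (L : signature) := Fctx { flen : nat; fsort : 'I_flen -> srt L }.

Coercion ctx_of_fctx L (x : fctx L) : ctx L := Ctx (@fsort L x).

Definition cnil L : ctx L := Ctx (fun v : void => match v with end).

Definition cext L (G : ctx L) (s : srt L) : ctx L :=
  Ctx (fun v : option (cvar G) => if v is Some w then csort w else s).

Definition csum L (G H : ctx L) : ctx L :=
  Ctx (fun v : cvar G + cvar H =>
         match v with inl w => csort w | inr w => csort w end).

Inductive term L (G : ctx L) : srt L -> Type :=
| Var (v : cvar G) : term G (csort v)
| App (f : fsym L) (u : forall i : 'I_(far f), term G (fdom i)) :
    term G (fcod f).

(* The variable bound by [FAll s] is [None] of [cext G s].                   *)
Inductive form L (G : ctx L) : Type :=
| FEq (s : srt L) (t u : term G s)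
| FRel (r : rsym L) (u : forall i : 'I_(rar r), term G (rdom i))
| FBot
| FImp (phi psi : form G)
| FAll (s : srt L) (phi : form (cext G s)).

Definition FNot L (G : ctx L) (phi : form G) : form G := FImp phi (FBot G).

Record structure L := Structure {
  carrier :> srt L -> Type;
  fint : forall f : fsym L,
    (forall i : 'I_(far f), carrier (fdom i)) -> carrier (fcod f);
  rint : forall r : rsym L,
    (forall i : 'I_(rar r), carrier (rdom i)) -> Prop
}.

Definition valuation L (M : structure L) (G : ctx L) : Type :=
  forall v : cvar G, M (csort v).

Definition vnil L (M : structure L) : valuation M (cnil L) :=
  fun v => match v with end.

Definition vext L (M : structure L) (G : ctx L) (e : valuation M G)
    (s : srt L) (a : M s) : valuation M (cext G s) :=
  fun v => match v return M (@csort L (cext G s) v) with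
           | Some w => e w
           | None => a
           end.

Definition vsum L (M : structure L) (G H : ctx L)
    (e : valuation M G) (e' : valuation M H) : valuation M (csum G H) :=
  fun v => match v return M (@csort L (csum G H) v) with
           | inl w => e w
           | inr w => e' w
           end.

Fixpoint eval L (M : structure L) (G : ctx L) (e : valuation M G)
    (s : srt L) (t : term G s) : M s :=
  match t with
  | Var v => e v
  | App f u => fint (fun i => eval e (u i))
  end.

Fixpoint sat L (M : structure L) (G : ctx L) (phi : form G) :
    valuation M G -> Prop :=
  match phi with
  | FEq s t u => fun e => eval e t = eval e u
  | FRel r u => fun e => rint (fun i => eval e (u i))
  | FBot => fun _ => False
  | FImp phi psi => fun e => sat phi e -> sat psi e
  | FAll s phi => fun e => forall a : M s, sat phi (vext e a)
  end.

Definition sentence L := form (cnil L).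

Definition models L (T : set (sentence L)) (M : structure L) : Prop :=
  forall sigma, T sigma -> sat sigma (vnil M).

Definition entails L (T : set (sentence L)) (sigma : sentence L) : Prop :=
  forall M : structure L, models T M -> sat sigma (vnil M).

Definition complete_theory L (T : set (sentence L)) : Prop :=
  (exists M : structure L, models T M) /\
  (forall sigma, entails T sigma \/ entails T (FNot sigma)).

Definition linear_order_on X (D : set X) (R : X -> X -> Prop) : Prop :=
  [/\ forall a, D a -> ~ R a a,
      forall a b c, D a -> D b -> D c -> R a b -> R b c -> R a c &
      forall a b, D a -> D b -> a <> b -> R a b \/ R b a].

Definition strict_order_on X (D : set X) (R : X -> X -> Prop) : Prop :=
  (forall a, D a -> ~ R a a) /\
  (forall a b c, D a -> D b -> D c -> R a b -> R b c -> R a c).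

Definition dense_on X (D : set X) (R : X -> X -> Prop) : Prop :=
  forall a b, D a -> D b -> R a b -> exists c, [/\ D c, R a c & R c b].

Definition equivalence_on X (D : set X) (E : X -> X -> Prop) : Prop :=
  [/\ forall a, D a -> E a a,
      forall a b, D a -> D b -> E a b -> E b a &
      forall a b c, D a -> D b -> D c -> E a b -> E b c -> E a c].

(* Every class of [E] on [D] is [R]-convex in [D].                           *)
Definition convex_relation_on X (D : set X) (R E : X -> X -> Prop) : Prop :=
  forall a b c, D a -> D b -> D c -> R a b -> R b c -> E a c -> E a b.

Definition quotient X (D : set X) (E : X -> X -> Prop) : set (set X) :=
  [set Y | exists2 a, D a & Y = [set b | D b /\ E a b]].

(* The order induced by [R] on pairwise disjoint [R]-convex sets.            *)
Definition quotient_lt X (R : X -> X -> Prop) (Y Z : set X) : Prop :=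
  forall a b, Y a -> Z b -> R a b.

Definition exactly_one (P Q : Prop) : Prop := (P /\ ~ Q) \/ (~ P /\ Q).

Section Model.

Variables (L : signature) (C : structure L).

Definition elem : Type := {s : srt L & C s}.

Definition pctx (A : set elem) : ctx L :=
  Ctx (fun c : {c : elem | A c} => projT1 (proj1_sig c)).

Definition params (A : set elem) : valuation C (pctx A) :=
  fun c => projT2 (proj1_sig c).

(* L(A)-formulas with free variables in G.                                   *)
Definition pform (A : set elem) (G : ctx L) : Type := form (csum G (pctx A)).

Definition psat (A : set elem) (G : ctx L) (phi : pform A G)
    (a : valuation C G) : Prop :=
  sat phi (vsum a (@params A)).

Definition realizes (A : set elem) (G : ctx L) (p : set (pform A G))
    (a : valuation C G) : Prop :=
  forall phi, p phi -> psat phi a.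

Definition finitely_satisfiable (A : set elem) (G : ctx L)
    (p : set (pform A G)) : Prop :=
  forall q : set (pform A G), finite_set q -> q `<=` p ->
    exists a, realizes q a.

(* [p] belongs to S(A).                                                      *)
Definition complete_type (A : set elem) (G : ctx L)
    (p : set (pform A G)) : Prop :=
  finitely_satisfiable p /\ (forall phi, p phi \/ p (FNot phi)).

Definition tp (G : ctx L) (a : valuation C G) (A : set elem) :
    set (pform A G) :=
  [set phi | psat phi a].
#[global] Arguments tp [G] a A : rename.

Record automorphism := Automorphism {
  aut :> forall s, C s -> C s;
  aut_bij : forall s, bijective (@aut s);
  aut_fint : forall (f : fsym L) (u : forall i : 'I_(far f), C (fdom i)),
    aut (fint u) = fint (fun i => aut (u i));
  aut_rint : forall (r : rsym L) (u : forall i : 'I_(rar r), C (rdom i)),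
    rint (fun i => aut (u i)) <-> rint u
}.

Definition fixes (sigma : automorphism) (A : set elem) : Prop :=
  forall c, A c -> sigma (projT1 c) (projT2 c) = projT2 c.

Definition card_lt X Y (A : set X) (B : set Y) : Prop :=
  A #<= B /\ ~ (B #<= A).

(* Cardinal smaller than that of [K], the saturation cardinal of the monster. *)
Definition small (K X : Type) (A : set X) : Prop := card_lt A [set: K].

Definition saturated (K : Type) : Prop :=
  forall A : set elem, small K A ->
  forall (x : fctx L) (p : set (pform A x)),
    finitely_satisfiable p -> exists a, realizes p a.

Definition strongly_homogeneous (K : Type) : Prop :=
  forall G : ctx L, small K [set: cvar G] ->
  forall e e' : valuation C G,
    (forall phi : form G, sat phi e <-> sat phi e') ->
    exists sigma : automorphism, forall v, sigma _ (e v) = e' v.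

Definition monster (T : set (sentence L)) (K : Type) : Prop :=
  [/\ models T C,
      small K [set: nat],
      [/\ small K [set: srt L], small K [set: fsym L] & small K [set: rsym L]],
      saturated K &
      strongly_homogeneous K].

Definition tup (x : fctx L) : Type := valuation C x.

Definition coords (x : fctx L) (a : tup x) : set elem :=
  [set existT (fun s => C s) (fsort i) (a i) | i in [set: 'I_(flen x)]].

Definition divides (A : set elem) (x y : fctx L) (phi : form (csum x y))
    (b : tup y) : Prop :=
  exists (b_ : nat -> tup y) (k : nat),
    [/\ (0 < k)%N,
        forall i, tp (b_ i) A = tp b A &
        forall f : 'I_k -> nat, injective f ->
          ~ exists a : tup x, forall j, sat phi (vsum a (b_ (f j)))].

(* A partial type over [D] forks over [A] if it implies (in [C]) a finite    *)
(* disjunction of formulas, each dividing over [A].                          *)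
Definition forks (A D : set elem) (x : fctx L) (p : set (pform D x)) : Prop :=
  exists (n : nat) (y : 'I_n -> fctx L)
         (phi : forall j, form (csum x (y j))) (b : forall j, tup (y j)),
    (forall j, divides A (phi j) (b j)) /\
    (forall a : tup x, realizes p a -> exists j, sat (phi j) (vsum a (b j))).

Definition indep (A : set elem) (x : fctx L) (a : tup x) (B : set elem) : Prop :=
  ~ forks A (tp a (A `|` B)).

(* A pair (p, <_p), where p is a set of L(A)-formulas in finitely many       *)
(* variables.                                                                *)
Record opair (A : set elem) := Opair {
  octx : fctx L;
  otype : set (pform A octx);
  olt : tup octx -> tup octx -> Prop
}.
#[global] Arguments octx [A] P : rename.
#[global] Arguments otype [A] P : rename.
#[global] Arguments olt [A] P a b : rename.

Definition locus (A : set elem) (P : opair A) : set (tup (octx P)) :=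
  [set a | realizes (otype P) a].
#[global] Arguments locus [A] P a : rename.

(* [R] is the trace on the set of realizations of [p] of an [A]-definable    *)
(* binary relation; in particular [R] is empty outside that set.             *)
Definition rel_definable (A : set elem) (x : fctx L) (p : set (pform A x))
    (R : tup x -> tup x -> Prop) : Prop :=
  exists phi : pform A (csum x x), forall a b,
    R a b <-> [/\ realizes p a, realizes p b & psat phi (vsum a b)].

Definition trace (A : set elem) (P : opair A) (D : set elem)
    (phi : pform D (octx P)) : set (tup (octx P)) :=
  locus P `&` [set a | psat phi a].
#[global] Arguments trace [A] P [D] phi a : rename.

Definition initial_segment (A : set elem) (P : opair A)
    (I : set (tup (octx P))) : Prop :=
  I `<=` locus P /\ (forall a b, I a -> locus P b -> olt P b a -> I b).
#[global] Arguments initial_segment [A] P I : rename.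

Definition final_segment (A : set elem) (P : opair A)
    (I : set (tup (octx P))) : Prop :=
  I `<=` locus P /\ (forall a b, I a -> locus P b -> olt P a b -> I b).
#[global] Arguments final_segment [A] P I : rename.

Definition left_eventual (A : set elem) (P : opair A)
    (X : set (tup (octx P))) : Prop :=
  exists I, [/\ initial_segment P I, I !=set0 & I `<=` X].
#[global] Arguments left_eventual [A] P X : rename.

Definition right_eventual (A : set elem) (P : opair A)
    (X : set (tup (octx P))) : Prop :=
  exists I, [/\ final_segment P I, I !=set0 & I `<=` X].
#[global] Arguments right_eventual [A] P X : rename.

Definition so_pair (A : set elem) (P : opair A) : Prop :=
  [/\ complete_type (otype P),
      rel_definable (otype P) (olt P),
      linear_order_on (locus P) (olt P) &
      forall phi : pform setT (octx P),
        exactly_one (left_eventual P (trace P phi))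
                    (left_eventual P (locus P `\` trace P phi)) /\
        exactly_one (right_eventual P (trace P phi))
                    (right_eventual P (locus P `\` trace P phi))].

Definition non_algebraic (A : set elem) (P : opair A) : Prop :=
  infinite_set (locus P).

(* The global types p_r and p_l are the case [D = setT]; for other [D] these *)
(* are their restrictions to [D].                                            *)
Definition right_type (A : set elem) (P : opair A) (D : set elem) :
    set (pform D (octx P)) :=
  [set phi | right_eventual P (trace P phi)].
#[global] Arguments right_type [A] P D : rename.

Definition left_type (A : set elem) (P : opair A) (D : set elem) :
    set (pform D (octx P)) :=
  [set phi | left_eventual P (trace P phi)].
#[global] Arguments left_type [A] P D : rename.

Definition right_generic (A : set elem) (P : opair A) (B : set elem)
    (a : tup (octx P)) : Prop :=
  locus P a /\ realizes (right_type P (A `|` B)) a.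
#[global] Arguments right_generic [A] P B a : rename.

Definition left_generic (A : set elem) (P : opair A) (B : set elem)
    (a : tup (octx P)) : Prop :=
  locus P a /\ realizes (left_type P (A `|` B)) a.
#[global] Arguments left_generic [A] P B a : rename.

Definition weakly_orthogonal (A : set elem) (x y : fctx L)
    (p : set (pform A x)) (q : set (pform A y)) : Prop :=
  forall phi : pform A (csum x y),
    (forall a b, realizes p a -> realizes q b -> psat phi (vsum a b)) \/
    (forall a b, realizes p a -> realizes q b -> psat (FNot phi) (vsum a b)).

Definition delta (A : set elem) (P Q : opair A) : Prop :=
  [/\ so_pair P, so_pair Q,
      ~ weakly_orthogonal (otype P) (otype Q) &
      forall a b, locus P a -> locus Q b ->
        (left_generic P (coords b) a <-> right_generic Q (coords a) b) /\
        (right_generic P (coords b) a <-> left_generic Q (coords a) b)].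

Definition delta_class (A : set elem) (P : opair A) : set (opair A) :=
  [set Q | [/\ so_pair Q, non_algebraic Q & delta P Q]].

(* A finite tuple of elements of [C], together with its sorts.               *)
Definition mpoint : Type := {x : fctx L & tup x}.

Definition pt (x : fctx L) (a : tup x) : mpoint := existT tup x a.

Definition aut_point (sigma : automorphism) (z : mpoint) : mpoint :=
  pt (fun i => sigma _ (projT2 z i)).

Definition type_of_pair (A : set elem) (P : opair A) :
    {x : fctx L & set (pform A x)} :=
  existT (fun x : fctx L => set (pform A x)) (octx P) (otype P).

(* p(C), as a set of points.                                                 *)
Definition locus_pt (A : set elem) (P : opair A) : set mpoint :=
  [set z | exists2 a : tup (octx P), locus P a & z = pt a].

(* F(C).                                                                     *)
Definition realizations (A : set elem) (F : set (opair A)) : set mpoint :=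
  [set z | exists2 P, F P & locus_pt P z].

(* Forking dependence over [A] as a relation on [D]; it is D_F when [D] is   *)
(* F(C), and D_p when [D] is p(C).                                           *)
Definition dep_on (A : set elem) (D : set mpoint) (z w : mpoint) : Prop :=
  [/\ D z, D w & ~ indep A (projT2 z) (coords (projT2 w))].

(* [tri F B z]: the point [z] satisfies B <|^F z.                            *)
Definition tri (A : set elem) (F : set (opair A)) (B : set elem) (z : mpoint) :
    Prop :=
  exists P (a : tup (octx P)),
    [/\ F P, locus P a, z = pt a & right_generic P B a].

(* The relation <|^F between points, via the coordinates of the first one.   *)
Definition tri_pt (A : set elem) (F : set (opair A)) (z w : mpoint) : Prop :=
  tri F (coords (projT2 z)) w.

Definition invariant_on (A : set elem) (D : set mpoint)
    (R : mpoint -> mpoint -> Prop) : Prop :=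
  forall sigma : automorphism, fixes sigma A ->
  forall z w, D z -> D w -> (R z w <-> R (aut_point sigma z) (aut_point sigma w)).

(* The pair (p, <_p) in which <_p is the restriction of [R] to p(C).         *)
Definition restr_pair (A : set elem) (P : opair A)
    (R : mpoint -> mpoint -> Prop) : opair A :=
  @Opair A (octx P) (otype P)
    (fun a b => [/\ locus P a, locus P b & R (pt a) (pt b)]).

End Model.

(* Main.v *)
Require Import Defs.
From Stdlib Require List.
From mathcomp Require Import all_boot.
From mathcomp Require Import boolp classical_sets functions cardinality wochoice.
Set Implicit Arguments.
Unset Strict Implicit.
Unset Printing Implicit Defensive.
Local Open Scope classical_set_scope.
Local Open Scope card_scope.

(* Write B <| a for right genericity. Strong homogeneity conjugates any two    *)
(* right generics over B, so if a is right generic over B then any tuple d has *)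
(* a conjugate d' over B such that a is right generic over B and d'. Choosing  *)
(* d generic over B, this single move shows that <| is transitive, dense and   *)
(* satisfies x <| z -> x <| y or y <| z along directly nonorthogonal pairs,    *)
(* and that direct nonorthogonality is transitive. Hence <| is a strict weak   *)
(* order on F(C).                                                              *)
(* Its incomparability relation is forking dependence: a right generic formula *)
(* does not divide, because its conjugates are all right eventual; a realizer  *)
(* generic on neither side lies in a bounded interval of p(C), which has       *)
(* infinitely many pairwise disjoint conjugates.                               *)
(* The order is obtained by refining <| inside each dependence class, first by *)
(* a linear order on the set of types and then by the given orders <_p; it     *)
(* restricts to <_p on p(C) because <_p extends <| there.                      *)

(** The relation [delta] is replaced by [dno], which keeps its equivalences and says that no
    realization is generic on both sides; [delta_dno] and [dno_delta] translate, and [dno_trans]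
    makes any two pairs of F directly nonorthogonal. Then [tri_ptP] shows that the relation between
    two points does not depend on the pairs presenting them.

    The strict weak order comes from [tri_pt_irr], [tri_pt_trans] and [tri_pt_weak]. Dependence is
    its incomparability relation ([dep_tri]): one half is [indep_right_generic], the other
    [dep_nongeneric]. Clause (ii) is then pure order theory: incomparability in a strict weak order
    is an equivalence, convex for every linear extension, and density ([tri_pt_dense]) passes to the
    quotient.

    One pair of F is selected for each type. The linear order restricts to the selected order on
    each locus, so the restricted pair of (iii) is itself a member of F; prescribing the selection
    for a family of distinct types gives the last claim. *)

(** * Renaming of variables *)

Section Renaming.
Variable L : signature.
Implicit Types G H : ctx L.

(** Sorts are preserved only up to a propositional equality while terms are indexed by their sort;
    hence the transports by [cast]. *)
Record ren G H := Ren {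
  rvar :> cvar G -> cvar H;
  rsrt : forall v, csort (rvar v) = csort v }.

Definition cast (T : srt L -> Type) s t (e : s = t) (x : T s) : T t :=
  eq_rect s T x t e.

Fixpoint rterm G H (r : ren G H) s (t : term G s) : term H s :=
  match t with
  | Var v => cast (rsrt r v) (Var (r v))
  | App f u => App (fun i => rterm r (u i))
  end.

Definition rext G H (r : ren G H) s : ren (cext G s) (cext H s) :=
  @Ren (cext G s) (cext H s) (omap r)
    (fun v => match v return csort (c := cext H s) (omap r v)
                             = csort (c := cext G s) v with
              | Some w => rsrt r w
              | None => erefl
              end).

Fixpoint rform G H (r : ren G H) (phi : form G) : form H :=
  match phi with
  | FEq _ t u => FEq (rterm r t) (rterm r u)
  | FRel _ u => FRel (fun i => rterm r (u i))
  | FBot => FBot H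
  | FImp phi psi => FImp (rform r phi) (rform r psi)
  | FAll s phi => FAll (rform (rext r s) phi)
  end.

Variable M : structure L.

Definition pull G H (r : ren G H) (e : valuation M H) : valuation M G :=
  fun v => cast (rsrt r v) (e (r v)).

Lemma eval_rterm G H (r : ren G H) (e : valuation M H) s (t : term G s) :
  eval e (rterm r t) = eval (pull r e) t.
Proof.
elim: t => [v|f u IH] /=; first by rewrite /pull; case: _ / (rsrt r v).
by congr fint; apply: functional_extensionality_dep.
Qed.

Lemma pull_vext G H (r : ren G H) (e : valuation M H) s (a : M s) :
  pull (rext r s) (vext e a) = vext (pull r e) a.
Proof. by apply: functional_extensionality_dep => -[v|]. Qed.

Lemma sat_rform G H (r : ren G H) (phi : form G) (e : valuation M H) :
  sat (rform r phi) e <-> sat phi (pull r e).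
Proof.
elim: phi H r e => {G} [G s t u|G q u|G|G p IHp q IHq|G s p IHp] H r e //=.
- by rewrite !eval_rterm.
- have -> // : (fun i => eval e (rterm r (u i)))
             = (fun i => eval (pull r e) (u i)).
  by apply: functional_extensionality_dep => i; rewrite eval_rterm.
- by split=> h /IHp/h/IHq.
- by split=> h a; have := h a; rewrite IHp pull_vext.
Qed.

(* The formula only involves the finitely many variables listed in [l], so it *)
(* is equivalent to a formula over any context that provides them.            *)
Lemma finite_support G (phi : form G) : exists l : list (cvar G),
  forall H (r : ren H G), (forall v, List.In v l -> exists w, r w = v) ->
  exists psi : form H, forall e : valuation M G, sat phi e <-> sat psi (pull r e).
Proof.
have tsupp G' s (t : term G' s) : exists l : list (cvar G'),
  forall H (r : ren H G'), (forall v, List.In v l -> exists w, r w = v) ->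
  exists t' : term H s, rterm r t' = t.
  elim: t => [v|f u IH].
    exists [:: v] => H r /(_ v (or_introl erefl)) [w <-].
    exists (cast (esym (rsrt r w)) (Var w)).
    (* Freeing the target sort allows elimination of the equality; proof irrelevance then collapses
       the composite transport. *)
    suff gen s0 (e : csort w = s0) : rterm r (cast e (Var w)) =
        cast (etrans (rsrt r w) e) (Var (r w)).
      by rewrite gen (Prop_irrelevance (etrans _ _) erefl).
    by case: _ / e.
  have [l lP] := choice IH.
  exists (flatten [seq l i | i <- enum 'I_(far f)]) => H r hr.
  have /(_ _)/cid-/all_sig[t' t'P] : forall i, exists t' : term H (fdom i), rterm r t' = u i.
    move=> i; apply: lP => v vl; apply: hr.
    have : i \in enum 'I_(far f) by rewrite mem_enum.
    elim: (enum _) => //= j js IHs; rewrite inE => /orP[/eqP <-|/IHs vs];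
      apply/List.in_or_app; by [left|right].
  exists (App t') => /=; congr App.
  exact: functional_extensionality_dep.
elim: phi => {G} [G s t u|G q u|G|G p [lp IHp] q [lq IHq]|G s p [lp IHp]].
- have [l1 h1] := tsupp _ _ t; have [l2 h2] := tsupp _ _ u.
  exists (l1 ++ l2) => H r hr.
  have [t' et] := h1 H r (fun v vl => hr v (List.in_or_app _ _ _ (or_introl vl))).
  have [u' eu] := h2 H r (fun v vl => hr v (List.in_or_app _ _ _ (or_intror vl))).
  by exists (FEq t' u') => e; rewrite -et -eu -sat_rform.
- have [l lP] := choice (fun i => tsupp _ _ (u i)).
  exists (flatten [seq l i | i <- enum 'I_(rar q)]) => H r hr.
  have /(_ _)/cid-/all_sig[t' t'P] : forall i, exists t' : term H (rdom i), rterm r t' = u i.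
    move=> i; apply: lP => v vl; apply: hr.
    have : i \in enum 'I_(rar q) by rewrite mem_enum.
    elim: (enum _) => //= j js IHs; rewrite inE => /orP[/eqP <-|/IHs vs];
      apply/List.in_or_app; by [left|right].
  exists (FRel t') => e; rewrite -sat_rform /=.
  by have -> : u = fun i => rterm r (t' i) by apply: functional_extensionality_dep.
- by exists [::] => H r _; exists (FBot H).
- exists (lp ++ lq) => H r hr.
  have [p' hp] := IHp H r (fun v vl => hr v (List.in_or_app _ _ _ (or_introl vl))).
  have [q' hq] := IHq H r (fun v vl => hr v (List.in_or_app _ _ _ (or_intror vl))).
  by exists (FImp p' q') => e; split=> h /hp/h/hq.
(* [pmap id] drops the bound variable [None], which [rext] always provides. *)
- exists (pmap id lp) => H r hr.
  have [|p' hp] := IHp _ (rext r s).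
    case=> [v|] vl; last by exists None.
    have [|w <-] := hr v; last by exists (Some w).
    elim: lp vl {hr IHp} => //= -[w|] lp' IH /= [e|/IH] //.
      by left; case: e.
    by right.
  exists (FAll p') => e /=.
  by split=> h a; have := h a; rewrite hp pull_vext.
Qed.

(* Dividing formulas carry no parameters: those of an L(A)-formula have to be  *)
(* moved into a finite tuple.                                                  *)
Lemma finite_parameters (x W : ctx L) (phi : form (csum x W)) :
  exists (n : nat) (h : 'I_n -> cvar W)
         (psi : form (csum x (Fctx (fun i => csort (h i))))),
  forall (a : valuation M x) (e : valuation M W),
    sat phi (vsum a e) <->
    sat psi (vsum (H := Fctx (fun i => csort (h i))) a (fun i => e (h i))).
Proof.
have [l lP] := finite_support phi.
pose l' := pmap (fun v => if v is inr w then Some w else None) l.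
pose h (i : 'I_(size l')) : cvar W := tnth (in_tuple l') i.
pose y : ctx L := Fctx (fun i => csort (h i)).
pose f (v : cvar (csum x y)) : cvar (csum x W) :=
  match v with inl u => inl u | inr i => inr (h i) end.
have @fs v : csort (f v) = csort v by case: v.
have [|psi psiP] := lP (csum x y) (Ren fs).
  case=> [u|w] vl; first by exists (inl u).
  have [i hi] : exists i, h i = w.
    have {}vl : List.In w l'.
      rewrite /l'; elim: l vl {lP l' h y f fs} => //= -[u|u] l IH /= [e|/IH] //.
        by left; case: e.
      by right.
    rewrite /h; move: l' vl {h y f fs lP} => l' vl.
    elim: l' vl => //= u l' IH [<-|/IH[i <-]].
      by exists ord0; rewrite (tnth_nth u).
    by exists (lift ord0 i); rewrite !(tnth_nth u).
  by exists (inr i); rewrite /= hi.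
exists (size l'), h, psi => a e; rewrite psiP.
have -> // : pull (Ren fs) (vsum a e)
    = vsum (H := Fctx (fun i => csort (h i))) a (fun i => e (h i)).
by apply: functional_extensionality_dep => -[].
Qed.

End Renaming.

(** * Small sets *)

Section Cardinality.

Lemma card_le_sigP X Y (D : set X) (E : set Y) :
  D #<= E <-> exists f : {x | D x} -> {y | E y}, injective f.
Proof.
split=> [/card_leP[f]|[f fi]].
  have sv (z : {x | D x}) : sval z \in D by apply/mem_set/(svalP z).
  exists (fun z => exist E (sval (f (SigSub (sv z)))) (set_mem (valP (f (SigSub (sv z)))))).
  move=> z w [] /val_inj /(@inj _ _ _ f); rewrite !inE => /(_ I I) [].
  by case: z w => z Dz [w Dw] /= e; move: Dw; rewrite -e => Dw; congr exist.
apply/card_leP.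
pose g (z : set_type D) : set_type E :=
  let w := f (exist D (val z) (set_mem (valP z))) in
  SigSub (mem_set (svalP w)).
apply/injfunPex; exists g => // z w _ _ [] e.
apply: val_inj.
have := fi (exist D (val z) (set_mem (valP z))) (exist D (val w) (set_mem (valP w))).
case: (f _) e => a Ea /=; case: (f _) => b Eb /= e; move: Eb; rewrite -e => Eb.
by rewrite (Prop_irrelevance Eb Ea) => /(_ erefl) [].
Qed.

Lemma small_le K X Y (D : set X) (E : set Y) : small K E -> D #<= E -> small K D.
Proof.
move=> [EK KE] DE; split; first exact: card_le_trans DE EK.
by move=> KD; apply: KE; exact: card_le_trans KD DE.
Qed.

Lemma finite_small K X (D : set X) :
  small K [set: nat] -> finite_set D -> small K D.
Proof. by move=> Knat /finite_set_countable Dc; exact: small_le Knat Dc. Qed.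

(** Hilbert's hotel: a copy [s] of the naturals inside [X] is shifted by [n], and the freed places
    receive ['I_n]. *)
Lemma infinite_absorb X n : infinite_set [set: X] ->
  exists f : 'I_n + X -> X, injective f.
Proof.
move=> /infiniteP/card_le_sigP[g gi].
pose s (k : nat) : X := sval (g (exist _ k I)).
have si : injective s.
  move=> i j e.
  suff /gi/(congr1 sval) : g (exist _ i I) = g (exist _ j I) by [].
  by apply: eq_sig_hprop => // ? ? ?; exact: Prop_irrelevance.
pose t (x : X) : X :=
  if pselect (exists k, s k = x) is left e then s (projT1 (cid e) + n) else x.
have ts k : t (s k) = s (k + n).
  rewrite /t; case: pselect => [e|[]]; last by exists k.
  by congr (s (_ + n)); apply: si; exact: (projT2 (cid e)).
have tn x : (forall k, s k <> x) -> t x = x.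
  by move=> xs; rewrite /t; case: pselect => // e; have [k /xs] := e.
have dich x : (exists k, s k = x) \/ (forall k, s k <> x).
  by case: (EM (exists k, s k = x)) => [|h]; [left|right => k e; apply: h; exists k].
exists (fun z : 'I_n + X => match z with inl i => s i | inr x => t x end).
move=> [i|x] [j|y].
- by move=> /si/val_inj ->.
- have [[k <-]|h] := dich y; last by rewrite tn // => /h.
  by rewrite ts => /si e; have := ltn_ord i; rewrite e ltnNge leq_addl.
- have [[k <-]|h] := dich x; last by rewrite tn // => /esym/h.
  by rewrite ts => /si e; have := ltn_ord j; rewrite -e ltnNge leq_addl.
- have [[k <-]|hx] := dich x; have [[l <-]|hy] := dich y; rewrite ?ts ?tn //.
  + by move=> /si/addIn ->.
  + by move=> /hy.
  + by move=> /esym/hx.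
  + by move=> ->.
Qed.

Lemma small_sum K X (D : set X) n : small K [set: nat] -> small K D ->
  small K [set: 'I_n + {x | D x}].
Proof.
move=> Knat KD; have [Dfin|Dinf] := EM (finite_set [set: {x | D x}]).
  apply: finite_small => //.
  have -> : [set: 'I_n + {x | D x}] = range inl `|` range inr.
    by apply/seteqP; split=> // -[i|x] _; [left; exists i|right; exists x].
  by rewrite finite_setU; split; apply: finite_image.
apply: small_le KD _; apply/card_le_sigP.
have [f fi] := infinite_absorb n Dinf.
by exists (fun z => f (sval z)) => -[z []] [w []] /fi /= ->.
Qed.

Lemma small_setU K X (D E : set X) : small K [set: nat] -> small K D ->
  finite_set E -> small K (D `|` E).
Proof.
move=> Knat KD [n /card_eqPle[/card_le_sigP[g gi] _]].
apply: small_le (small_sum n Knat KD) _; apply/card_le_sigP.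
pose f (z : {x | (D `|` E) x}) : 'I_n + {x | D x} :=
  match pselect (D (sval z)) with
  | left h => inr (exist D _ h)
  | right h => let w := g (exist E (sval z)
       (match svalP z with or_introl d => False_ind _ (h d) | or_intror e => e end)) in
     inl (Ordinal (svalP w))
  end.
exists (fun z => exist _ (f z) I) => z w [].
rewrite /f; case: pselect => hz; case: pselect => hw // [] e.
  by apply: eq_sig_hprop => // ? ? ?; exact: Prop_irrelevance.
apply: eq_sig_hprop => [? ? ?|]; first exact: Prop_irrelevance.
have : forall a b : {x | `I_n x}, sval a = sval b -> a = b.
  by move=> a b ?; apply: eq_sig_hprop => // ? ? ?; exact: Prop_irrelevance.
by move=> /(_ _ _ e)/gi [].
Qed.

End Cardinality.

(** * Automorphisms and definable sets *)

Section Definable.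
Variables (L : signature) (C : structure L).
Implicit Types (s : automorphism C) (G W : ctx L) (A B D E : set (elem C)).

Definition vact s G (a : valuation C G) : valuation C G := fun v => s _ (a v).

Definition eact s (c : elem C) : elem C := existT _ (projT1 c) (s _ (projT2 c)).

Lemma eval_aut s G (e : valuation C G) t (u : term G t) :
  eval (vact s e) u = s _ (eval e u).
Proof.
elim: u => [v|f u IH] //=; rewrite aut_fint; congr fint.
exact: functional_extensionality_dep.
Qed.

Lemma sat_aut s G (phi : form G) (e : valuation C G) :
  sat phi (vact s e) <-> sat phi e.
Proof.
elim: phi e => {G} [G t u w|G r u|G|G p IHp q IHq|G t p IHp] e //=.
- by rewrite !eval_aut; split=> [/(bij_inj (aut_bij _ _))|->].
- have -> : (fun i => eval (vact s e) (u i)) = (fun i => s _ (eval e (u i))).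
    by apply: functional_extensionality_dep => i; rewrite eval_aut.
  exact: aut_rint.
- by split=> h /IHp/h/IHq.
- have ext a : vext (vact s e) (s t a) = vact s (vext e a).
    by apply: functional_extensionality_dep => -[v|].
  split=> h a; first by apply/IHp; rewrite -ext; exact: h.
  have [g _ gK] := aut_bij s t.
  by rewrite -(gK a) ext; apply/IHp.
Qed.

Lemma vact_vsum s G W (a : valuation C G) (e : valuation C W) :
  vact s (vsum a e) = vsum (vact s a) (vact s e).
Proof. by apply: functional_extensionality_dep => -[]. Qed.

Lemma vact_surj s G (a : valuation C G) : exists b, vact s b = a.
Proof.
have /(_ _)/cid-/all_sig[b bP] : forall v, exists x, s _ x = a v.
  by move=> v; have [g _ gK] := aut_bij s (csort v); exists (g (a v)).
by exists b; apply: functional_extensionality_dep.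
Qed.

Lemma eact_inj s : injective (eact s).
Proof.
have sinv t := cid (let: Bijective g h _ := aut_bij s t in ex_intro _ g h).
pose g t := sval (sinv t).
pose gact (c : elem C) : elem C := existT _ (projT1 c) (g _ (projT2 c)).
apply: (can_inj (g := gact)) => -[t c].
by congr existT; exact: (svalP (sinv t)).
Qed.

Lemma fixesP s D : fixes s D <-> forall c, D c -> eact s c = c.
Proof.
split=> h c Dc; first by rewrite /eact h //; case: c Dc.
have := h c Dc; case: c Dc => t c Dc e /=.
have := projT2_eq e; rewrite (Prop_irrelevance (projT1_eq e) erefl).
exact.
Qed.

Lemma fixes_sub s D E : D `<=` E -> fixes s E -> fixes s D.
Proof. by move=> DE sE c /DE/sE. Qed.

Lemma fixes_image s D : fixes s D -> eact s @` D = D.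
Proof.
move=> /fixesP h; apply/seteqP; split=> [_ [c Dc <-]|c Dc]; first by rewrite h.
by exists c; rewrite ?h.
Qed.

Lemma coords_vact s (x : fctx L) (a : tup C x) :
  coords (vact s a) = eact s @` coords a.
Proof.
apply/seteqP; split=> [_ [i _ <-]|_ [_ [i _ <-] <-]].
  by exists (existT (fun t => C t) (fsort i) (a i)) => //; exists i.
by exists i.
Qed.

Lemma fixes_coords s (x : fctx L) (a : tup C x) :
  fixes s (coords a) -> vact s a = a.
Proof.
move=> h; apply: functional_extensionality_dep => i.
exact: (h (existT (fun t => C t) (fsort i) (a i)) (ex_intro2 _ _ i I erefl)).
Qed.

Lemma finite_coords (x : fctx L) (a : tup C x) : finite_set (coords a).
Proof. exact: finite_image. Qed.

(** Formulas over different parameter sets have different Rocq types; passing to the sets they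
    define makes them comparable. *)
Definition dset D G (S : set (valuation C G)) : Prop :=
  exists phi : pform D G, S = [set a | psat phi a].

Lemma dset_psat D G (phi : pform D G) : dset D [set a | psat phi a].
Proof. by exists phi. Qed.

Lemma vsum_pull G W W' (r : ren W W') (a : valuation C G) (e : valuation C W')
    (f : forall v, csort (match v with inl g => inl g | inr w => inr (r w) end
                          : cvar (csum G W')) = csort (v : cvar (csum G W))) :
  pull (@Ren L (csum G W) (csum G W') _ f) (vsum a e) = vsum a (pull r e).
Proof.
apply: functional_extensionality_dep => -[g|w]; rewrite /pull /=.
  by rewrite (Prop_irrelevance (f (inl g)) erefl).
by rewrite (Prop_irrelevance (f (inr w)) (rsrt r w)).
Qed.

Lemma dset_params D G W (phi : form (csum G W)) (e : valuation C W) :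
  (forall w, D (existT (fun t => C t) (csort w) (e w))) ->
  dset D [set a | sat phi (vsum a e)].
Proof.
move=> De.
pose r : ren W (pctx D) :=
  @Ren L W (pctx D) (fun w => exist D _ (De w)) (fun w => erefl).
have f : forall v, csort (match v with inl g => inl g | inr w => inr (r w) end
           : cvar (csum G (pctx D))) = csort (v : cvar (csum G W)) by case.
exists (rform (@Ren L (csum G W) (csum G (pctx D)) _ f) phi).
have E a := vsum_pull a (@params _ C D) f.
by apply/seteqP; split=> a h; [apply/sat_rform|move/sat_rform: h]; rewrite E.
Qed.

Lemma dset_sub D E G (S : set (valuation C G)) :
  D `<=` E -> dset D S -> dset E S.
Proof.
by move=> DE [phi ->]; apply: dset_params => -[[t c] Dc]; exact: DE.
Qed.

Lemma dset_setC D G (S : set (valuation C G)) : dset D S -> dset D (~` S).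
Proof. by move=> [phi ->]; exists (FNot phi). Qed.

Lemma dset_setI D G (S U : set (valuation C G)) :
  dset D S -> dset D U -> dset D (S `&` U).
Proof.
move=> [phi ->] [psi ->]; exists (FNot (FImp phi (FNot psi))).
apply/seteqP; split=> a /=; rewrite /psat /=; first by move=> [h1 h2] /(_ h1 h2).
by move=> h; split; apply: contrapT => h'; apply: h => // h1 h2.
Qed.

(** The parameters are pulled back along [s]: the tuple [b] with image the given parameters takes
    its values in [D]. *)
Lemma dset_preimage D s G (S : set (valuation C G)) :
  dset (eact s @` D) S -> dset D (@vact s G @^-1` S).
Proof.
move=> [phi ->].
have [b bP] := vact_surj s (params (A := eact s @` D)).
suff -> : @vact s G @^-1` [set a | psat phi a] = [set a | sat phi (vsum a b)].
  apply: dset_params => w.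
  have [c Dc ec] := svalP w.
  suff -> : existT (fun t => C t) (csort w) (b w) = c by [].
  apply: (@eact_inj s); rewrite ec /eact /=.
  have := congr1 (fun f => f w) bP; rewrite /vact /= => ->.
  by rewrite /params; case: (sval w).
apply/seteqP; split=> a h.
  by apply/(sat_aut s); rewrite vact_vsum bP.
by move/(sat_aut s): h; rewrite vact_vsum bP.
Qed.

Lemma dset_slice A D G (y : fctx L) (phi : pform A (csum G y)) (b : tup C y) :
  A `|` coords b `<=` D -> dset D [set a | psat phi (vsum a b)].
Proof.
move=> AD.
pose W := csum y (pctx A).
pose f (v : cvar (csum (csum G y) (pctx A))) : cvar (csum G W) :=
  match v with inl (inl g) => inl g | inl (inr i) => inr (inl i)
             | inr c => inr (inr c) end.
have @fs v : csort (f v) = csort v by case: v => [[|]|].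
have -> : [set a | psat phi (vsum a b)] =
    [set a | sat (rform (Ren fs) phi) (vsum a (vsum b (@params _ C A)))].
  have e a : pull (Ren fs) (vsum a (vsum b (@params _ C A))) =
      vsum (vsum a b) (@params _ C A).
    by apply: functional_extensionality_dep => -[[]|].
  by apply/seteqP; split=> a; rewrite /= /psat sat_rform e.
apply: dset_params => -[i|[[t c] Ac]]; apply: AD; last by left.
by right; exists i.
Qed.

Lemma psat_swap A (x y : ctx L) (phi : pform A (csum x y)) :
  exists psi : pform A (csum y x), forall a b,
    psat psi (vsum b a) <-> psat phi (vsum a b).
Proof.
pose f (v : cvar (csum (csum x y) (pctx A))) : cvar (csum (csum y x) (pctx A)) :=
  match v with inl (inl g) => inl (inr g) | inl (inr i) => inl (inl i)
             | inr c => inr c end.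
have @fs v : csort (f v) = csort v by case: v => [[|]|].
exists (rform (Ren fs) phi) => a b; rewrite /psat sat_rform.
suff -> : pull (Ren fs) (vsum (vsum b a) (@params _ C A)) =
  vsum (vsum a b) (@params _ C A) by [].
by apply: functional_extensionality_dep => -[[]|].
Qed.

Lemma psat_aut s A G (phi : pform A G) (a : valuation C G) :
  fixes s A -> psat phi (vact s a) <-> psat phi a.
Proof.
move=> sA; rewrite /psat.
have pA : vact s (@params _ C A) = @params _ C A.
  by apply: functional_extensionality_dep => c; rewrite /vact (sA _ (svalP c)).
by rewrite -{1}pA -vact_vsum; exact: sat_aut.
Qed.

Lemma realizes_aut s A G (p : set (pform A G)) (a : valuation C G) :
  fixes s A -> realizes p (vact s a) <-> realizes p a.
Proof. by move=> sA; split=> h phi /h; rewrite (psat_aut _ _ sA). Qed.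

Lemma tp_aut s A G (a : valuation C G) : fixes s A -> tp (vact s a) A = tp a A.
Proof. by move=> sA; apply/seteqP; split=> phi; rewrite /tp /= psat_aut. Qed.


End Definable.

(** * The monster model *)

Section Monster.
Variables (L : signature) (T : set (sentence L)) (C : structure L) (K : Type).
Hypothesis C_monster : monster C T K.

Lemma nat_small : small K [set: nat].
Proof. by case: C_monster. Qed.

Lemma homogeneity (x : fctx L) (D : set (elem C)) (a b : tup C x) :
  small K D -> tp a D = tp b D ->
  exists2 s : automorphism C, fixes s D & vact s a = b.
Proof.
move=> KD ab; have [_ _ _ _ hom] := C_monster.
have [|phi|s sP] := hom (csum x (pctx D)) _ (vsum a (@params _ C D))
                        (vsum b (@params _ C D)).
- exact: (small_sum (flen x) nat_small KD).
- by have := congr1 (fun p => p phi) ab; rewrite /tp /= /psat => ->.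
exists s; first by move=> c Dc; exact: (sP (inr (exist _ c Dc))).
by apply: functional_extensionality_dep => i; exact: (sP (inl i)).
Qed.

(** Saturation for a filter base of definable sets: closure under intersection reduces finite
    satisfiability to nonemptiness of the members. *)
Lemma saturation (x : fctx L) (D : set (elem C)) (F : set (set (tup C x))) :
  small K D -> F `<=` @dset L C D x -> F !=set0 ->
  (forall S U, F S -> F U -> F (S `&` U)) ->
  (forall S, F S -> S !=set0) -> exists a, forall S, F S -> S a.
Proof.
move=> KD FD [S0 FS0] FI F0; have [_ _ _ sat _] := C_monster.
have [|a aP] := sat D KD x [set phi | F [set a | psat phi a]]; last first.
  by exists a => S /[dup] FS /FD [phi e]; have := aP phi; rewrite /= -e => /(_ FS);
     rewrite e.
move=> q /(@finite_seqP {classic (pform D x)})[l ->] {q} lF.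
suff [S FS Sl] : exists2 S, F S & forall phi, phi \in l -> S `<=` [set a | psat phi a].
  by have [a Sa] := F0 S FS; exists a => phi /Sl; exact.
elim: l lF => [_|phi l IH lF]; first by exists S0.
have [psi hpsi|S FS Sl] := IH.
  by apply: lF; rewrite /= inE; apply/orP; right.
exists (S `&` [set a | psat phi a]).
  by apply: FI => //; apply: lF; rewrite /= inE eqxx.
by move=> psi; rewrite inE => /orP[/eqP -> a []//|/Sl h a [/h]].
Qed.

Variable A : set (elem C).
Hypothesis A_small : small K A.

Lemma small_parameters B : finite_set B -> small K (A `|` B).
Proof. by move=> Bfin; apply: small_setU => //; exact: nat_small. Qed.

(** * Generic realizations of so-pairs *)

(** Left genericity for [P] is convertible to right genericity for [opp_pair P], so lemmas about the
    right side also serve the left. *)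
Definition opp_pair (P : opair A) : opair A :=
  @Opair L C A (octx P) (otype P) (fun a b => olt P b a).

Lemma so_pair_opp P : so_pair P -> so_pair (opp_pair P).
Proof.
move=> [cP [phi phiP] [irr tr tot] ev]; split=> //.
- have [psi psiP] := psat_swap phi.
  by exists psi => a b /=; rewrite phiP (propext (psiP _ _)); split=> -[].
- split=> //= [a b c la lb lc ab bc|a b la lb ab]; first exact: tr bc ab.
  by have [|] := tot a b la lb ab; [right|left].
- by move=> psi; have [] := ev psi.
Qed.

Section SoPair.
Variable P : opair A.
Hypothesis P_so : so_pair P.
Implicit Types (a b : tup C (octx P)) (B D : set (elem C)).

Local Notation re S := (right_eventual P (locus P `&` S)).

Lemma locus_tp a : locus P a -> otype P = tp a A.
Proof.
case: P_so => -[_ cP] _ _ _ la; apply/seteqP; split=> phi; first exact: la.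
by move=> h; have [//|/la] := cP phi; move/(_ h).
Qed.

Lemma locus_aut s a : fixes s A -> locus P (vact s a) <-> locus P a.
Proof. exact: realizes_aut. Qed.

Lemma locus_conj a b : locus P a -> locus P b ->
  exists2 s : automorphism C, fixes s A & vact s a = b.
Proof.
by move=> /locus_tp ta /locus_tp tb; apply: homogeneity; rewrite // -ta.
Qed.

Lemma locus_neq0 : locus P !=set0.
Proof.
have [_ _ _ sat _] := C_monster; case: P_so => -[fs _] _ _ _.
exact: sat fs.
Qed.

Lemma olt_aut s a b : fixes s A -> olt P (vact s a) (vact s b) <-> olt P a b.
Proof.
move=> sA; case: P_so => _ [phi phiP] _ _; rewrite !phiP.
by rewrite -vact_vsum !(propext (realizes_aut _ _ sA)) (propext (psat_aut _ _ sA)).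
Qed.

Lemma olt_locus a b : olt P a b -> locus P a /\ locus P b.
Proof. by case: P_so => _ [phi phiP] _ _ /phiP[]. Qed.

Lemma olt_irr a : ~ olt P a a.
Proof.
by move=> aa; have [la _] := olt_locus aa; case: P_so => _ _ [irr _ _] _; exact: irr aa.
Qed.

Lemma olt_trans a b c : olt P a b -> olt P b c -> olt P a c.
Proof.
move=> ab bc; have [la lb] := olt_locus ab; have [_ lc] := olt_locus bc.
by case: P_so => _ _ [_ tr _] _; exact: tr ab bc.
Qed.

Lemma olt_total a b : locus P a -> locus P b -> [\/ olt P a b, a = b | olt P b a].
Proof.
move=> la lb; case: P_so => _ _ [_ _ tot] _.
have [->|/tot[]//] := EM (a = b); by [constructor 2|constructor 1|constructor 3].
Qed.

Lemma dset_olt c : locus P c ->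
  (exists2 S, dset (A `|` coords c) S & forall a, locus P a -> S a <-> olt P c a) /\
  (exists2 S, dset (A `|` coords c) S & forall a, locus P a -> S a <-> olt P a c).
Proof.
move=> lc; case: P_so => _ [phi phiP] _ _; have [psi psiP] := psat_swap phi; split.
  exists [set a | psat psi (vsum a c)]; first exact: dset_slice.
  by move=> a la /=; rewrite phiP (propext (psiP _ _)); split=> [|[]].
exists [set a | psat phi (vsum a c)]; first exact: dset_slice.
by move=> a la /=; rewrite phiP; split=> [|[]].
Qed.

Lemma re_sub (S U : set (tup C (octx P))) :
  (forall a, locus P a -> S a -> U a) -> re S -> re U.
Proof.
move=> SU [I [I1 I2 I3]]; exists I; split=> // a /I3[la Sa]; split=> //; exact: SU.
Qed.

Lemma final_total (I J : set (tup C (octx P))) :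
  final_segment P I -> final_segment P J -> I `<=` J \/ J `<=` I.
Proof.
move=> [I1 I2] [J1 J2]; have [|/existsNP[a /not_implyP[Ia nJa]]] := EM (I `<=` J).
  by left.
right=> b Jb; have [ab|<- //|ba] := olt_total (I1 _ Ia) (J1 _ Jb).
  exact: I2 Ia (J1 _ Jb) ab.
by case: nJa; exact: J2 Jb (I1 _ Ia) ba.
Qed.

Lemma re_setI S U : re S -> re U -> re (S `&` U).
Proof.
move=> [I [I1 I2 I3]] [J [J1 J2 J3]]; have [IJ|JI] := final_total I1 J1.
  by exists I; split=> // a Ia; have [] := I3 _ Ia; have [] := J3 _ (IJ _ Ia).
by exists J; split=> // a Ja; have [] := J3 _ Ja; have [] := I3 _ (JI _ Ja).
Qed.

Lemma re_neq0 S : re S -> exists2 a, locus P a & S a.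
Proof. by move=> [I [_ [a Ia] /(_ _ Ia)[]]]; exists a. Qed.

Lemma re_locus : re (locus P).
Proof. by exists (locus P); split=> //; [split|exact: locus_neq0]. Qed.

Lemma re_setC D S : dset D S -> re S \/ re (~` S).
Proof.
move=> /(dset_sub (@subsetT _ D))[phi ->]; case: P_so => _ _ _ /(_ phi)[_].
rewrite /trace (_ : _ `\` _ = locus P `&` ~` [set a | psat phi a]); last first.
  by apply/seteqP; split=> a [la] h; split=> //; [move=> ?; apply: h|move=> [_]].
by case=> -[? ?]; [left|right].
Qed.

Lemma re_aut s S : fixes s A -> re S -> re (@vact L C s (octx P) @^-1` S).
Proof.
move=> sA [I [[I1 I1'] [a Ia] I3]]; exists (@vact L C s (octx P) @^-1` I); split.
- split=> [b /I1/(locus_aut _ sA)//|b c Ib lc bc].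
  by apply: I1' Ib _ _; [exact/locus_aut|exact/olt_aut].
- by have [b ab] := vact_surj s a; exists b; rewrite /= ab.
- by move=> b /I3[/(locus_aut _ sA) lb Sb].
Qed.

(** With the bound stated as a negation, [c] itself witnesses nonemptiness, and no element above [c]
    has to be produced. *)
Lemma re_above c : locus P c -> re [set a | ~ olt P a c].
Proof.
move=> lc; exists (locus P `&` [set a | ~ olt P a c]); split=> //.
  split=> [a []//|a b [la ac] lb ab]; split=> // bc; apply: ac; exact: olt_trans ab bc.
by exists c; split=> //=; exact: olt_irr.
Qed.

Lemma right_genericP B a : right_generic P B a <->
  locus P a /\ forall S, dset (A `|` B) S -> re S -> S a.
Proof.
split=> -[la h]; split=> //; first by move=> S [phi ->]; exact: h.
by move=> phi; exact: h (dset_psat phi).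
Qed.

(** If [S] were not right eventual its complement would be, and genericity would put [a] in the
    complement. *)
Lemma right_generic_compl B a S :
  right_generic P B a -> dset (A `|` B) S -> S a -> re S.
Proof.
move=> /right_genericP[la h] dS Sa; have [//|/h] := re_setC dS.
by move=> /(_ (dset_setC dS)).
Qed.

Lemma right_generic_sub B D a : B `<=` D -> right_generic P D a -> right_generic P B a.
Proof.
move=> BD /right_genericP[la h]; apply/right_genericP; split=> // S dS; apply: h.
by apply: dset_sub dS => c [|/BD]; [left|right].
Qed.

Lemma right_generic_exists B : finite_set B -> exists a, right_generic P B a.
Proof.
move=> Bfin.
have [| | | |a aP] := saturation (F := [set S | dset (A `|` B) S /\ re S])
    (small_parameters Bfin).
- by move=> S [].
- exists setT; split; last by apply: re_sub re_locus.
  by exists (FNot (FBot _)); apply/seteqP; split=> [a _ []|].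
- by move=> S U [dS rS] [dU rU]; split; [exact: dset_setI|exact: re_setI].
- by move=> S [_ /re_neq0[a _ Sa]]; exists a.
exists a; apply/right_genericP; split=> [phi pphi|S dS rS]; last exact: aP.
apply: (aP [set a | psat phi a]); split.
  by apply: dset_sub (dset_psat phi); left.
by apply: re_sub re_locus => b lb _; exact: lb.
Qed.

Lemma right_generic_tp B a b :
  right_generic P B a -> right_generic P B b -> tp a (A `|` B) = tp b (A `|` B).
Proof.
move=> ga gb; apply/seteqP; split=> phi /= h.
  have /right_genericP[_] := gb; apply; first exact: dset_psat.
  exact: right_generic_compl ga (dset_psat phi) h.
have /right_genericP[_] := ga; apply; first exact: dset_psat.
exact: right_generic_compl gb (dset_psat phi) h.
Qed.

Lemma right_generic_conj B a b : finite_set B ->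
  right_generic P B a -> right_generic P B b ->
  exists2 s : automorphism C, fixes s (A `|` B) & vact s a = b.
Proof.
move=> Bfin ga gb; apply: homogeneity; first exact: small_parameters.
exact: right_generic_tp.
Qed.

Lemma right_generic_aut s B a : fixes s A ->
  right_generic P B a -> right_generic P (eact s @` B) (vact s a).
Proof.
move=> sA /right_genericP[la h]; apply/right_genericP; split; first exact/locus_aut.
move=> S dS rS; have := h (@vact L C s (octx P) @^-1` S); apply; last exact: re_aut.
by apply: dset_preimage; rewrite image_setU fixes_image.
Qed.

Lemma right_generic_fix s B a : fixes s (A `|` B) ->
  right_generic P B a -> right_generic P B (vact s a).
Proof.
move=> sAB /(right_generic_aut (fixes_sub (@subsetUl _ _ _) sAB)).
by rewrite fixes_image //; exact: fixes_sub (@subsetUr _ _ _) sAB.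
Qed.

Lemma right_generic_bound B a c :
  right_generic P (B `|` coords c) a -> locus P c -> ~ olt P a c.
Proof.
move=> /right_genericP[la h] lc ac; have [_ [S dS SP]] := dset_olt lc.
have /h : dset (A `|` (B `|` coords c)) (~` S).
  by apply/dset_setC/(dset_sub _ dS) => d [|]; [left|right; right].
have rS : re (~` S) by apply: re_sub (re_above lc) => b lb bc /(SP _ lb).
by move=> /(_ rS); apply; apply/SP.
Qed.

(* Conjugating over [B], one may assume that [a] lies above any given bound. *)
Lemma right_generic_up B a b : finite_set B ->
  right_generic P B a -> olt P a b -> right_generic P B b.
Proof.
move=> Bfin ga ab; have [la lb] := olt_locus ab.
apply/right_genericP; split=> // S dS rS; apply: contrapT => nSb.
have [I [[I1 I2] [c Ic] I3]] := rS; have lc := I1 _ Ic.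
have [|a' ga'] := @right_generic_exists (B `|` coords c).
  by rewrite finite_setU; split=> //; exact: finite_coords.
have [s sAB sa] := right_generic_conj Bfin ga (right_generic_sub (@subsetUl _ _ _) ga').
have sA := fixes_sub (@subsetUl _ _ _) sAB.
have cb : olt P c (vact s b).
  have := right_generic_bound ga' lc.
  have := ab; rewrite -(olt_aut _ _ sA) sa => a'b.
  have [/olt_trans/(_ a'b)//|->//|//] := olt_total lc (proj1 (olt_locus a'b)).
have [_ Sb] := I3 _ (I2 c _ Ic (proj2 (olt_locus cb)) cb).
move: dS => [phi e]; apply: nSb; move: Sb; rewrite e => /= Sb.
by apply/(psat_aut _ _ sAB).
Qed.

(** Take [a'] generic over [B] and [d]; conjugating [a'] back to [a] over [B] leaves [a] in place
    and moves [d] instead. *)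
Lemma right_generic_extend B a (y : fctx L) (d : tup C y) : finite_set B ->
  right_generic P B a -> exists2 s : automorphism C, fixes s (A `|` B) &
    right_generic P (B `|` coords (vact s d)) a.
Proof.
move=> Bfin ga.
have [|a' ga'] := @right_generic_exists (B `|` coords d).
  by rewrite finite_setU; split=> //; exact: finite_coords.
have [s sAB sa] := right_generic_conj Bfin (right_generic_sub (@subsetUl _ _ _) ga') ga.
exists s => //; have sA := fixes_sub (@subsetUl _ _ _) sAB.
have := right_generic_aut sA ga'; rewrite sa image_setU -coords_vact fixes_image //.
exact: fixes_sub (@subsetUr _ _ _) sAB.
Qed.

End SoPair.
End Monster.

(** * Direct nonorthogonality *)

Section Delta.
Variables (L : signature) (T : set (sentence L)) (C : structure L) (K : Type).
Hypothesis C_monster : monster C T K.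
Variable A : set (elem C).
Hypothesis A_small : small K A.
Implicit Types P Q R : opair A.

(** Conjugates two tuples at once, possibly in different contexts, by their joint type over [A]. *)
Lemma homogeneity_pair (x y : fctx L) (a a' : tup C x) (b b' : tup C y) :
  (forall phi : pform A (csum x y), psat phi (vsum a b) <-> psat phi (vsum a' b')) ->
  exists s : automorphism C, [/\ fixes s A, vact s a = a' & vact s b = b'].
Proof.
move=> ab; have [_ _ _ _ hom] := C_monster.
have [|phi|s sP] := hom (csum (csum x y) (pctx A)) _
    (vsum (vsum a b) (@params _ C A)) (vsum (vsum a' b') (@params _ C A)).
- have sm := small_sum (flen x) (nat_small C_monster)
    (small_sum (flen y) (nat_small C_monster) A_small).
  apply: small_le sm _; apply/card_le_sigP.
  pose f (v : cvar (csum (csum x y) (pctx A))) :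
      'I_(flen x) + {w : 'I_(flen y) + {c | A c} | True} :=
    match v with inl (inl i) => inl i | inl (inr j) => inr (exist _ (inl j) I)
               | inr c => inr (exist _ (inr c) I) end.
  exists (fun v => exist _ (f (sval v)) I) => -[v []] [w []] /(congr1 sval) /=.
  by case: v w => [[i|j]|c] [[i'|j']|c'] //= [->].
- exact: ab.
exists s; split.
- by move=> c Ac; exact: (sP (inr (exist _ c Ac))).
- by apply: functional_extensionality_dep => i; exact: (sP (inl (inl i))).
- by apply: functional_extensionality_dep => i; exact: (sP (inl (inr i))).
Qed.

(* The content of [delta] without the so-pair clauses: for so-pairs satisfying *)
(* the equivalences, weak nonorthogonality amounts to the second clause. In    *)
(* this form the relation is visibly symmetric and stable under [opp_pair].    *)
Definition dno P Q : Prop :=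
  (forall a b, locus P a -> locus Q b ->
     (left_generic P (coords b) a <-> right_generic Q (coords a) b) /\
     (right_generic P (coords b) a <-> left_generic Q (coords a) b)) /\
  (forall a b, locus P a ->
     right_generic Q (coords a) b -> left_generic Q (coords a) b -> False).

Lemma dno_opp P Q : dno P Q -> dno (opp_pair P) (opp_pair Q).
Proof.
move=> [h1 h2]; split=> [a b la lb|a b la r l]; last exact: h2 la l r.
by have [? ?] := h1 a b la lb; split.
Qed.

Lemma dno_sym P Q : dno P Q -> dno Q P.
Proof.
move=> [h1 h2]; split=> [b a lb la|b a lb r l].
  by have [? ?] := h1 a b la lb; split; apply: iff_sym.
have la : locus P a by case: r.
by have [h h'] := h1 a b la lb; exact: h2 la (proj1 h l) (proj1 h' r).
Qed.

(** If [b] is generic over [a] on both sides, everything above [b] is right generic over [a] and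
    everything below is left generic. So all realizations of the second type are conjugate to [b]
    over [a], and the two types are weakly orthogonal. *)
Lemma delta_dno P Q : delta P Q -> dno P Q.
Proof.
move=> [soP soQ nwo h1]; split=> // a b la rb lb; apply: nwo => phi.
have gen a' b' : locus P a' -> locus Q b' ->
    psat phi (vsum a' b') <-> psat phi (vsum a b).
  move=> la' lb'.
  have [s sA sa] := locus_conj C_monster A_small soP la' la.
  have lsb : locus Q (vact s b') by apply/locus_aut.
  have [t tA tb] : exists2 t : automorphism C, fixes t (A `|` coords a) &
      vact t (vact s b') = b.
    have fin := finite_coords a.
    have [ltb|->|gtb] := olt_total soQ lsb (proj1 rb).
    - have lbo : right_generic (opp_pair Q) (coords a) b := lb.
      have lb2 := right_generic_up C_monster A_small (so_pair_opp soQ) fin lbo ltb.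
      exact: (right_generic_conj C_monster A_small (so_pair_opp soQ) fin lb2 lbo).
    - exact: (right_generic_conj C_monster A_small soQ fin rb rb).
    - apply: (right_generic_conj C_monster A_small soQ fin _ rb).
      exact: (right_generic_up C_monster A_small soQ fin rb gtb).
  have tfA := fixes_sub (@subsetUl _ _ _) tA.
  rewrite -(psat_aut phi _ sA) -(psat_aut phi _ tfA) !vact_vsum sa tb.
  by rewrite fixes_coords //; exact: fixes_sub (@subsetUr _ _ _) tA.
have [h|h] := EM (psat phi (vsum a b)); [left|right] => a' b' la' lb'.
  exact/gen.
by move=> /(gen _ _ la' lb').
Qed.

(** Under weak orthogonality a left and a right generic over [a] are conjugate by an automorphism
    fixing [a], so one tuple would be generic on both sides. *)
Lemma dno_delta P Q : so_pair P -> so_pair Q -> dno P Q -> delta P Q.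
Proof.
move=> soP soQ [h1 h2]; split=> // wo.
have [a la] := locus_neq0 C_monster A_small soP.
have [b rb] := right_generic_exists C_monster A_small soQ (finite_coords a).
have [b' lb'] :=
  right_generic_exists C_monster A_small (so_pair_opp soQ) (finite_coords a).
have [|s [sA sa sb]] := @homogeneity_pair _ _ a a b' b.
  move=> phi; have [h|h] := wo phi; first by split=> _; apply: h => //; case: rb lb' => ? _ [].
  by split=> h'; case: (h a _ la _ h') => //; case: rb lb' => ? _ [].
apply: h2 la rb _; rewrite -sb.
have := right_generic_aut (so_pair_opp soQ) sA lb'.
by rewrite -coords_vact sa.
Qed.

(* If [d] is generic over [B] and [a] is generic over [B, d], then [d] is left *)
(* generic over [a], hence lies below [b].                                     *)
Lemma right_generic_trans P Q B a b : so_pair P -> so_pair Q -> dno P Q ->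
  finite_set B -> right_generic P B a -> right_generic Q (coords a) b ->
  right_generic Q B b.
Proof.
move=> soP soQ [h1 h2] Bfin ga gb.
have [d gd] := right_generic_exists C_monster A_small soQ Bfin.
have [s sAB ga'] := right_generic_extend C_monster A_small soP d Bfin ga.
have gd' := right_generic_fix soQ sAB gd.
have ld : left_generic Q (coords a) (vact s d).
  apply/(proj2 (h1 a _ (proj1 ga) (proj1 gd'))).
  exact: right_generic_sub (@subsetUr _ _ _) ga'.
have [bd|bd|db] := olt_total soQ (proj1 gb) (proj1 gd').
- case: (h2 a b) => //; first by case: ga.
  exact: (right_generic_up C_monster A_small (so_pair_opp soQ) (finite_coords a) ld bd).
- by case: (h2 a b) => //; [case: ga|rewrite bd].
- exact: (right_generic_up C_monster A_small soQ Bfin gd' db).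
Qed.

Lemma left_generic_between P R a (y : fctx L) (b : tup C y) :
  so_pair P -> so_pair R -> left_generic P (coords b) a ->
  exists2 c, left_generic R (coords b) c & left_generic P (coords c) a.
Proof.
move=> soP soR ga.
have [c gc] :=
  right_generic_exists C_monster A_small (so_pair_opp soR) (finite_coords b).
have [s sb ga'] :=
  right_generic_extend C_monster A_small (so_pair_opp soP) c (finite_coords b) ga.
exists (vact s c); first exact: (right_generic_fix (so_pair_opp soR) sb gc).
exact: (right_generic_sub (@subsetUr _ _ _) ga').
Qed.

(** [left_generic_between] gives [c] left generic over [b] with [a] left generic over [c]. The two
    [dno] hypotheses turn this into [c] right generic over [a] and [b] right generic over [c], which
    compose by [right_generic_trans]. *)
Lemma left_to_right_generic R P Q a b : so_pair R -> so_pair P -> so_pair Q ->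
  dno R P -> dno R Q -> locus Q b ->
  left_generic P (coords b) a -> right_generic Q (coords a) b.
Proof.
move=> soR soP soQ RP RQ lb ga.
have [c gcb gac] := left_generic_between soP soR ga.
have lc : locus R c by case: gcb.
have la : locus P a by case: ga.
apply: (right_generic_trans (a := c) soR soQ RQ (finite_coords a)).
  by apply/(proj2 (proj1 RP c a lc la)).
by apply/(proj1 (proj1 RQ c b lc lb)).
Qed.

Lemma dno_trans R P Q : so_pair R -> so_pair P -> so_pair Q ->
  dno R P -> dno R Q -> dno P Q.
Proof.
move=> soR soP soQ RP RQ.
have iffs a b : locus P a -> locus Q b ->
     (left_generic P (coords b) a <-> right_generic Q (coords a) b) /\
     (right_generic P (coords b) a <-> left_generic Q (coords a) b).
  move=> la lb; split; split=> h.
  - exact: (left_to_right_generic soR soP soQ RP RQ lb h).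
  - exact: (left_to_right_generic (so_pair_opp soR) (so_pair_opp soQ)
      (so_pair_opp soP) (dno_opp RQ) (dno_opp RP) la h).
  - exact: (left_to_right_generic (so_pair_opp soR) (so_pair_opp soP)
      (so_pair_opp soQ) (dno_opp RP) (dno_opp RQ) lb h).
  - exact: (left_to_right_generic soR soQ soP RQ RP la h).
split=> // a b la rb lb.
(* If [b] is generic over [a] on both sides, [a] is so over [b]. Interpolating in [R] on each side
   gives [c] and [c']; the chain from [c] through [b] and [c'] to [a] makes [a] right generic over
   [c], while [a] is also left generic over [c]. *)
have locb : locus Q b by case: rb.
have [c gcb gac] := left_generic_between soP soR (proj2 (proj1 (iffs a b la locb)) rb).
have [c' gcb' gac'] : exists2 c', right_generic R (coords b) c' &
    right_generic P (coords c') a.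
  exact: (left_generic_between (so_pair_opp soP) (so_pair_opp soR)
    (proj2 (proj2 (iffs a b la locb)) lb)).
have lc : locus R c by case: gcb.
have gbc : right_generic Q (coords c) b by apply/(proj1 (proj1 RQ c b lc locb)).
have gcc' : right_generic R (coords c) c'.
  exact: (right_generic_trans soQ soR (dno_sym RQ) (finite_coords c) gbc gcb').
apply: (proj2 RP) lc _ gac.
exact: (right_generic_trans soR soP RP (finite_coords c) gcc' gac').
Qed.

End Delta.

(** * Forking on the locus of a so-pair *)

Section Forking.
Variables (L : signature) (T : set (sentence L)) (C : structure L) (K : Type).
Hypothesis C_monster : monster C T K.
Variable A : set (elem C).
Hypothesis A_small : small K A.
Implicit Types P Q : opair A.

Lemma realizes_tp D (x : fctx L) (a b : tup C x) S :
  realizes (tp a D) b -> dset D S -> S a -> S b.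
Proof. by move=> ab [phi ->]; exact: ab. Qed.

(** A realization [a'] generic over [B] and all parameters [b j] satisfies one of the dividing
    formulas, which is therefore right eventual. Its conjugates are right eventual too, so any [k]
    of them have a common realizer, against dividing. *)
Lemma indep_right_generic P B (a : tup C (octx P)) : so_pair P -> finite_set B ->
  right_generic P B a -> indep A a B.
Proof.
move=> soP Bfin ga [n [y [phi [b [div cov]]]]].
pose E := B `|` \bigcup_(j in [set: 'I_n]) coords (b j).
have Efin : finite_set E.
  rewrite finite_setU; split=> //; apply: bigcup_finite => // j _.
  exact: finite_coords.
have [a' ga'] := right_generic_exists C_monster A_small soP Efin.
have [|j hj] := cov a'.
  rewrite (right_generic_tp soP ga (right_generic_sub _ ga')) //.
  exact: subsetUl.
pose S : set (tup C (octx P)) := [set x | sat (phi j) (vsum x (b j))].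
have reS : right_eventual P (locus P `&` S).
  apply: (right_generic_compl soP ga') hj.
  by apply: dset_params => w; right; right; exists j => //; exists w.
have [b_ [k [k0 bb incons]]] := div j.
have reSi i :
    right_eventual P (locus P `&` [set x | sat (phi j) (vsum x (b_ i))]).
  have [s sA sb] := homogeneity C_monster A_small (bb i).
  apply: re_sub (re_aut soP sA reS) => x _; rewrite /S /= -sb.
  have -> : vsum (vact s x) (vact s (b_ i)) = vact s (vsum x (b_ i)) by rewrite vact_vsum.
  by move/sat_aut.
have reI m : right_eventual P
    (locus P `&` [set x | forall i, i < m -> sat (phi j) (vsum x (b_ i))]).
  elim: m => [|m IH]; first by apply: re_sub (re_locus C_monster A_small soP) => x _ _ i.
  apply: re_sub (re_setI soP IH (reSi m)) => x _ [h1 h2] i.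
  by rewrite ltnS leq_eqVlt => /orP[/eqP ->|/h1].
have [x _ hx] := re_neq0 (reI k).
by apply: (incons val val_inj); exists x => i; exact: (hx i (ltn_ord i)).
Qed.

(** A failure of genericity places [a] outside some right-eventual [S] over [A] and [B]; the
    complement of [S] lies below any point [u] of a final segment contained in [S]. *)
Lemma nongeneric_bound P B (a : tup C (octx P)) : so_pair P -> locus P a ->
  ~ right_generic P B a -> exists U u, [/\ dset (A `|` B) U, U a, locus P u &
    forall x, locus P x -> U x -> olt P x u].
Proof.
move=> soP la nga.
have [S [dS rS nSa]] : exists S, [/\ dset (A `|` B) S,
    right_eventual P (locus P `&` S) & ~ S a].
  apply: contrapT => h; apply: nga; apply/right_genericP; split=> // S dS rS.
  by apply: contrapT => nSa; apply: h; exists S.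
have [I [[I1 I2] [u Iu] I3]] := rS.
exists (~` S), u; split=> //; [exact: dset_setC|exact: I1|].
move=> x lx nSx; have [//|xu|ux] := olt_total soP lx (I1 _ Iu); case: nSx.
  by rewrite xu; have [] := I3 _ Iu.
by have [] := I3 _ (I2 _ _ Iu lx ux).
Qed.

Lemma right_generic_pair_conj P Q a a' b b' : so_pair P -> so_pair Q ->
  locus P a -> locus P a' ->
  right_generic Q (coords a) b -> right_generic Q (coords a') b' ->
  exists s : automorphism C, [/\ fixes s A, vact s a = a' & vact s b = b'].
Proof.
move=> soP soQ la la' gb gb'; apply: (homogeneity_pair C_monster A_small) => phi.
have [s sA sa] := locus_conj C_monster A_small soP la la'.
have gsb := right_generic_aut soQ sA gb; rewrite -coords_vact sa in gsb.
have [t tA tb] := right_generic_conj C_monster A_small soQ (finite_coords a') gsb gb'.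
have tfA := fixes_sub (@subsetUl _ _ _) tA.
have tfa := fixes_coords (fixes_sub (@subsetUr _ _ _) tA).
by rewrite -(psat_aut phi _ sA) -(psat_aut phi _ tfA) !vact_vsum sa tb tfa.
Qed.

(** [phi] is only known to define the order on the locus; the conjunct [pi], later a formula of the
    type, keeps the intervals disjoint among arbitrary tuples. *)
Lemma interval_formula (x : ctx L) (pi : pform A x) (phi : pform A (csum x x)) :
  exists chi : form (csum x (csum (csum x x) (pctx A))), forall a c d,
    sat chi (vsum a (vsum (vsum c d) (@params _ C A))) <->
    [/\ psat pi a, psat phi (vsum c a) & psat phi (vsum a d)].
Proof.
pose W := csum (csum x x) (pctx A).
pose f0 (v : cvar (csum x (pctx A))) : cvar (csum x W) :=
  match v with inl i => inl i | inr c => inr (inr c) end.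
have @fs0 v : csort (f0 v) = csort v by case: v.
pose f1 (v : cvar W) : cvar (csum x W) :=
  match v with inl (inl i) => inr (inl (inl i)) | inl (inr i) => inl i
             | inr c => inr (inr c) end.
have @fs1 v : csort (f1 v) = csort v by case: v => [[|]|].
pose f2 (v : cvar W) : cvar (csum x W) :=
  match v with inl (inl i) => inl i | inl (inr i) => inr (inl (inr i))
             | inr c => inr (inr c) end.
have @fs2 v : csort (f2 v) = csort v by case: v => [[|]|].
exists (FNot (FImp (rform (Ren fs0) pi)
        (FImp (rform (Ren fs1) phi) (FNot (rform (Ren fs2) phi))))).
move=> a c d; set e := vsum a _ => /=; rewrite !sat_rform.
have -> : pull (Ren fs0) e = vsum a (@params _ C A).
  by apply: functional_extensionality_dep => -[].
have -> : pull (Ren fs1) e = vsum (vsum c a) (@params _ C A).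
  by apply: functional_extensionality_dep => -[[]|].
have -> : pull (Ren fs2) e = vsum (vsum a d) (@params _ C A).
  by apply: functional_extensionality_dep => -[[]|].
split=> [h|[h1 h2 h3] /(_ h1 h2 h3)//].
by split; apply: contrapT => h'; apply: h => h1 h2 h3.
Qed.

(* A nongeneric [a] lies in an interval ]v, c2[ with [c2] generic over [v].    *)
(* Along a sequence [c] with [c n.+1] generic over [c n], the intervals        *)
(* ](c (2 i)), (c (2 i).+1)[ are conjugates of it and are pairwise disjoint.   *)
Lemma dep_nongeneric P B (a : tup C (octx P)) : so_pair P -> dno P P ->
  locus P a -> ~ right_generic P B a -> ~ left_generic P B a -> ~ indep A a B.
Proof.
move=> soP PP la nr nl; apply; have [_ [phi phiP] _ _] := soP.
have [U [u [dU Ua lu Uu]]] := nongeneric_bound soP la nr.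
have [V [v [dV Va lv Vv]]] := nongeneric_bound (so_pair_opp soP) la nl.
have fin2 (c d : tup C (octx P)) : finite_set (coords c `|` coords d).
  by rewrite finite_setU; split; exact: finite_coords.
(* Genericity over [v] makes [(v, c2)] conjugate to the pairs taken from the sequence; genericity
   over [u] puts [c2] above every element of [U]. *)
have [c2 gc2] := right_generic_exists C_monster A_small soP (fin2 v u).
have gvc2 := right_generic_sub (@subsetUl _ _ _) gc2.
have [g gP] := choice (fun c : tup C (octx P) =>
  right_generic_exists C_monster A_small soP (finite_coords c)).
pose c n := iter n g v.
have lc n : locus P (c n) by case: n => [|n] //; case: (gP (c n)).
have gc i j : i < j -> right_generic P (coords (c i)) (c j).
  elim: j => // j IH; rewrite ltnS leq_eqVlt => /orP[/eqP ->|/IH gij]; first exact: gP.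
  exact: (right_generic_trans C_monster A_small soP soP PP (finite_coords _) gij (gP _)).
(* No realization of the type lies both below [c 0] and above [c 1]; by compactness one formula of
   the type already excludes this. *)
have [pi [piv disj]] : exists pi : pform A (octx P), psat pi v /\
    forall x, psat pi x -> psat phi (vsum x (c 0)) -> psat phi (vsum (c 1) x) -> False.
  apply: contrapT => h.
  have [psi psiP] := psat_swap phi.
  pose D := A `|` (coords (c 0) `|` coords (c 1)).
  pose E := [set x | psat phi (vsum x (c 0))] `&` [set x | psat psi (vsum x (c 1))].
  have dE : dset D E.
    apply: dset_setI; apply: dset_slice => e [Ae|ce]; try by left.
      by right; left.
    by right; right.
  have [| | | |x xP] := saturation C_monster (F := [set X | exists S,
      [/\ dset A S, S v & X = S `&` E]])
      (small_parameters C_monster A_small (fin2 (c 0) (c 1))).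
  - move=> _ [S [dS _ ->]]; apply: dset_setI => //.
    by apply: dset_sub dS; left.
  - exists (setT `&` E), setT; split=> //.
    by exists (FNot (FBot _)); apply/seteqP; split=> [x _ []|].
  - move=> _ _ [S [dS Sv ->]] [S' [dS' Sv' ->]]; exists (S `&` S').
    by split; [exact: dset_setI|split|rewrite setIACA setIid].
  - move=> _ [_ [[pi ->] piv ->]]; apply: contrapT => h'; apply: h; exists pi.
    by split=> // x pix hx hx'; apply: h'; exists x; split=> //; split=> //=; apply/psiP.
  have lx : locus P x.
    move=> theta ptheta.
    have [|//] := xP ([set x | psat theta x] `&` E).
    by exists [set x | psat theta x]; split=> //; [exact: dset_psat|exact: lv].
  have [|_ [/= x0 /psiP x1]] := xP (setT `&` E).
    by exists setT; split=> //; exists (FNot (FBot _)); apply/seteqP; split=> [y _ []|].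
  have xc0 : olt P x (c 0) by apply/phiP.
  have xc1 : olt P (c 1) x by apply/phiP; split=> //; exact: lc 1.
  have c01 : olt P (c 1) (c 0) := olt_trans soP xc1 xc0.
  apply: (right_generic_bound (B := coords v) soP _ lv c01).
  by rewrite setUid; exact: (gc 0 1 isT).
have disjoint i j x : i < j -> psat pi x -> psat phi (vsum x (c i)) ->
    psat phi (vsum (c j) x) -> False.
  move=> ij hpi hi hj.
  have [s [sA si sj]] := right_generic_pair_conj soP soP (lc i) (lc 0) (gc i j ij)
    (gc 0 1 isT).
  apply: (disj (vact s x)); first exact/psat_aut.
    by rewrite -si -vact_vsum; apply/psat_aut.
  by rewrite -sj -vact_vsum; apply/psat_aut.
have [chi chiP] := interval_formula pi phi.
have [n [h [chi' chi'P]]] := finite_parameters C chi.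
pose e i := vsum (vsum (c i.*2) (c i.*2.+1)) (@params _ C A).
pose e0 := vsum (vsum v c2) (@params _ C A).
(* A single dividing formula suffices: the interval between [v] and [c2], with its parameters cut
   down to the finitely many that occur. *)
exists 1, (fun _ => Fctx (fun i => csort (h i))), (fun _ => chi'), (fun _ i => e0 (h i)).
split=> [_|x xP]; last first.
  have lx : locus P x.
    move=> theta /la ath; apply: (realizes_tp xP (S := [set a | psat theta a])) ath.
    by apply: dset_sub (dset_psat theta); left.
  have xu := Uu _ lx (realizes_tp xP dU Ua).
  have vx : olt P v x := Vv _ lx (realizes_tp xP dV Va).
  have xc2 : olt P x c2.
    have nuc2 : ~ olt P c2 u.
      apply: (right_generic_bound (B := coords v) soP _ lu); exact: gc2.
    have [uc2|<- //|//] := olt_total soP lu (proj1 gc2); exact: olt_trans xu uc2.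
  exists ord0; apply/(chi'P x e0)/chiP; split.
  - have : tp v A pi by [].
    by rewrite -(locus_tp soP lv) => /lx.
  - by have /phiP[] := vx.
  - by have /phiP[] := xc2.
(* Dividing holds with [k = 2], since the conjugate intervals are pairwise disjoint. *)
exists (fun k i => e k (h i)), 2; split=> // [k|f finj [x xP]].
  have [s [sA s1 s2]] := right_generic_pair_conj soP soP lv (lc k.*2) gvc2
    (gc k.*2 k.*2.+1 (ltnSn _)).
  have ek : e k = vact s e0.
    rewrite /e0 !vact_vsum s1 s2; congr vsum.
    by apply: functional_extensionality_dep => p; rewrite /vact (sA _ (svalP p)).
  by rewrite ek; exact: (tp_aut (G := Fctx (fun i => csort (h i))) (fun i => e0 (h i)) sA).
have hx j := proj1 (chiP _ _ _) (proj2 (chi'P x (e (f j))) (xP j)).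
have main i j : f i < f j -> False.
  move=> ij; have [hpi _ hi] := hx i; have [_ hj _] := hx j.
  by apply: disjoint hpi hi hj; rewrite ltn_Sdouble.
have [/main//|/main//|/finj//] := ltngtP (f ord0) (f ord_max).
Qed.

End Forking.

(** * Linear extensions of strict weak orders *)

Lemma exists_linear_order (X : Type) :
  exists R : X -> X -> Prop, linear_order_on [set: X] R.
Proof.
have [R Rwo] := well_ordering_principle {classic X}.
(* The well-order is given through least elements of nonempty sets; antisymmetry, transitivity and
   totality are read off from sets of at most three elements. *)
have min x y z : exists m : {classic X},
    [/\ m = x \/ m = y \/ m = z, R m x, R m y & R m z].
  have [|m [[mP lb] _]] := Rwo (mem [:: x; y; z]); first by exists x; rewrite !inE eqxx.
  exists m; split; try by apply: lb; rewrite !inE eqxx ?orbT.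
  by move: mP; rewrite !inE => /or3P[] /eqP; [left|right; left|right; right].
have anti x y : R x y -> R y x -> x = y.
  move=> xy yx; have [|m [_ mU]] := Rwo (mem [:: x; y]).
    by exists x; rewrite !inE eqxx.
  have [z [zP z1 z2 _]] := min x y y.
  have refl t : R t t by have [m' [[|[|]] -> //]] := min t t t.
  rewrite -(mU x) ?(mU y) //; split; rewrite ?inE ?eqxx ?orbT //;
    by move=> t; rewrite !inE => /orP[] /eqP ->.
exists (fun x y => R x y /\ x <> y); split=> [a _ []//|a b c _ _ _ [ab nab] [bc nbc]|a b _ _ ab].
- have [m [mP ma mb mc]] := min a b c; split.
    case: mP => [<-//|[] e]; subst m; first by case: nab; exact: anti.
    by case: nbc; exact: anti.
  by move=> ac; subst c; apply: nab; exact: anti.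
- have [m [[|[|]] -> h1 h2 _]] := min a b b; [left|right|right]; split=> //; exact: nesym.
Qed.

Section LinearExtension.
Variables (X K : Type) (D : set X) (R : X -> X -> Prop).
Hypothesis R_irr : forall a, D a -> ~ R a a.
Hypothesis R_tr : forall a b c, D a -> D b -> D c -> R a b -> R b c -> R a c.
Hypothesis R_weak : forall a b c, D a -> D b -> D c -> R a b -> R a c \/ R c b.

Section Lexi.
Variables (k : X -> K) (ltK : K -> K -> Prop) (lt : X -> X -> Prop).
Hypothesis ltK_lin : linear_order_on [set: K] ltK.
Hypothesis lt_lin : forall t, linear_order_on [set a | D a /\ k a = t] lt.

(** Lexicographic: [R] decides first, ties go to the keys, and [lt] is consulted only inside a fibre
    of [k], the only place where it is assumed linear. *)
Definition refine (a b : X) : Prop :=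
  R a b \/ ~ R b a /\ (ltK (k a) (k b) \/ k a = k b /\ lt a b).

Lemma refine_linear : linear_order_on D refine.
Proof.
have [Kirr Ktr Ktot] := ltK_lin.
have asym a b : D a -> D b -> R a b -> ~ R b a.
  by move=> Da Db ab ba; apply: (R_irr Da); exact: R_tr ab ba.
split.
- move=> a Da [/(R_irr Da)//|[_ [/(Kirr _ I)//|[_]]]].
  by have [irr _ _] := lt_lin (k a); exact: irr.
- move=> a b c Da Db Dc ab bc.
  have nba : ~ R b a by case: ab => [/asym|[]]; exact.
  have ncb : ~ R c b by case: bc => [/asym|[]]; exact.
  have [h|nRab] := EM (R a b).
    by left; have [//|/ncb] := R_weak Da Db Dc h.
  have [h|nRbc] := EM (R b c).
    by left; have [/nba|//] := R_weak Db Dc Da h.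
  case: ab => // -[_ ab]; case: bc => // -[_ bc]; right; split.
    by move=> /(R_weak Dc Da Db)[/ncb|/nba].
  case: ab => [ab|[kab ab]]; case: bc => [bc|[kbc bc]].
  + left; exact: (Ktr _ _ _ I I I ab bc).
  + by left; rewrite -kbc.
  + by left; rewrite kab.
  + right; split; first by rewrite kab.
    have [_ tr _] := lt_lin (k a).
    by apply: tr ab bc; split=> //; rewrite kab.
- move=> a b Da Db ab.
  have [h|nab] := EM (R a b); first by left; left.
  have [h|nba] := EM (R b a); first by right; left.
  have [e|ne] := EM (k a = k b).
    have [_ _ tot] := lt_lin (k b).
    have [//|//|//|h|h] := tot a b; [left|right]; right; split=> //; by right.
  by have [h|h] := Ktot _ _ I I ne; [left|right]; right; split=> //; left.
Qed.

End Lexi.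

Variables (E S : X -> X -> Prop).
Hypothesis E_iff : forall a b, D a -> D b -> (E a b <-> ~ R a b /\ ~ R b a).
Hypothesis S_lin : linear_order_on D S.
Hypothesis S_ext : forall a b, D a -> D b -> R a b -> S a b.

Lemma incomparability_equivalence : equivalence_on D E.
Proof.
split.
- by move=> a Da; apply/E_iff => //; split; exact: R_irr.
- by move=> a b Da Db /(E_iff Da Db)[h1 h2]; apply/E_iff.
- move=> a b c Da Db Dc /(E_iff Da Db)[h1 h2] /(E_iff Db Dc)[h3 h4].
  apply/E_iff => //; split; first by move=> /(R_weak Da Dc Db)[].
  by move=> /(R_weak Dc Da Db)[].
Qed.

Let S_asym a b : D a -> D b -> S a b -> S b a -> False.
Proof.
by case: S_lin => irr tr _ Da Db ab ba; apply: (irr a) => //; exact: tr ab ba.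
Qed.

Lemma incomparability_convex : convex_relation_on D S E.
Proof.
move=> a b c Da Db Dc ab bc /(E_iff Da Dc)[h1 h2]; apply/E_iff => //; split.
  move=> /(R_weak Da Db Dc)[//|/(S_ext Dc Db)].
  exact: S_asym.
by move=> /(S_ext Db Da); exact: S_asym.
Qed.

(** Two uses of [R_weak] replace each endpoint by an incomparable one, so the order of two classes
    is decided by any representatives. *)
Lemma incomparable_congr a a' b b' : D a -> D a' -> D b -> D b' ->
  E a a' -> E b b' -> R a b -> R a' b'.
Proof.
move=> Da Da' Db Db' /(E_iff Da Da')[h1 h2] /(E_iff Db Db')[h3 h4].
move=> /(R_weak Da Db Da')[//|/(R_weak Da' Db Db')[//|//]].
Qed.

Lemma quotient_linear : linear_order_on (quotient D E) (quotient_lt S).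
Proof.
have [Er Es Et] := incomparability_equivalence; have [irr tr tot] := S_lin.
split.
- move=> _ [a Da ->] /(_ a a) h; apply: (irr a) => //.
  by apply: h; split=> //; exact: Er.
- move=> _ _ _ [a Da ->] [b Db ->] [c Dc ->] h1 h2 x z hx hz.
  have hb : [set y | D y /\ E b y] b by split=> //; exact: Er.
  by apply: tr (h1 _ _ hx hb) (h2 _ _ hb hz) => //; [case: hx|case: hz].
- move=> _ _ [a Da ->] [b Db ->] ne.
  have nE : ~ E a b.
    move=> ab; apply: ne; apply/seteqP; split=> c [Dc h]; split=> //.
      by apply: Et h => //; exact: Es.
    exact: Et h.
  have [ab|nab] := EM (R a b).
    left=> x y [Dx ax] [Dy byy]; apply: S_ext => //.
    exact: incomparable_congr ax byy ab.
  have ba : R b a by apply: contrapT => nba; apply: nE; apply/E_iff.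
  right=> x y [Dx bx] [Dy ay]; apply: S_ext => //.
  exact: incomparable_congr bx ay ba.
Qed.

Lemma quotient_dense : dense_on D R -> dense_on (quotient D E) (quotient_lt S).
Proof.
have [Er Es Et] := incomparability_equivalence; have [irr tr tot] := S_lin.
move=> R_dense _ _ [a Da ->] [b Db ->] h.
have haa : [set y | D y /\ E a y] a by split=> //; exact: Er.
have hbb : [set y | D y /\ E b y] b by split=> //; exact: Er.
have Sab := h a b haa hbb.
(* Otherwise [a] and [b] are incomparable, [b] lies in both classes, and [h] gives [S b b]. *)
have Rab : R a b.
  apply: contrapT => nab.
  have nba : ~ R b a by move=> /(S_ext Db Da); exact: S_asym.
  by apply: (irr b) => //; apply: h => //; split=> //; apply/E_iff.
have [c [Dc ac cb]] := R_dense a b Da Db Rab.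
exists [set y | D y /\ E c y]; split; first by exists c.
  move=> x y [Dx ax] [Dy cy]; apply: S_ext => //; exact: incomparable_congr ax cy ac.
move=> x y [Dx cx] [Dy byy]; apply: S_ext => //; exact: incomparable_congr cx byy cb.
Qed.

End LinearExtension.

(** * Families of directly nonorthogonal so-pairs *)

Lemma pt_inj (L : signature) (C : structure L) (x : fctx L) : injective (@pt L C x).
Proof.
move=> a b e; have := projT2_eq e.
by rewrite (Prop_irrelevance (projT1_eq e) erefl).
Qed.

Section Family.
Variables (L : signature) (T : set (sentence L)) (C : structure L) (K : Type).
Hypothesis C_monster : monster C T K.
Variable A : set (elem C).
Hypothesis A_small : small K A.
Variable F : set (opair A).
Hypothesis F_so : forall P, F P -> so_pair P.
Hypothesis F_dno : forall P Q, F P -> F Q -> dno P Q.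
Implicit Types (P Q : opair A) (z w : mpoint C).

Local Notation FC := (realizations F).

(** The point may be presented through another pair [Q'] of F. For either pair the condition amounts
    to [a] being left generic over the coordinates of [b], which do not mention the pair. *)
Lemma tri_ptP P Q (a : tup C (octx P)) (b : tup C (octx Q)) :
  F P -> F Q -> locus P a -> locus Q b ->
  tri_pt F (pt a) (pt b) <-> right_generic Q (coords a) b.
Proof.
move=> FP FQ la lb; split=> [[Q' [b' [FQ' lb' e g]]]|g]; last by exists Q, b.
have [h' _] := proj1 (F_dno FP FQ') a b' la lb'.
have cb : coords b = coords b' := congr1 (fun z => coords (projT2 z)) e.
by apply/(proj1 (proj1 (F_dno FP FQ) a b la lb)); rewrite cb; apply/h'.
Qed.

Lemma tri_pt_irr z : FC z -> ~ tri_pt F z z.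
Proof.
move=> [P FP [a la ->]] /(tri_ptP FP FP la la) g.
apply: (proj2 (F_dno FP FP) a a la g).
exact/(proj2 (proj1 (F_dno FP FP) a a la la)).
Qed.

Lemma tri_pt_trans z w v : FC z -> FC w -> FC v ->
  tri_pt F z w -> tri_pt F w v -> tri_pt F z v.
Proof.
move=> [P FP [a la ->]] [Q FQ [b lb ->]] [R FR [c lc ->]].
move=> /(tri_ptP FP FQ la lb) ab /(tri_ptP FQ FR lb lc) bc.
apply/tri_ptP => //.
exact: (right_generic_trans C_monster A_small (F_so FQ) (F_so FR) (F_dno FQ FR)
  (finite_coords a) ab bc).
Qed.

(** Choose [d] right generic over [a] with [b] right generic over [d]. If [c] is not right generic
    over [a], it lies below [d]; as [d] is left generic over [b], so is [c]. *)
Lemma tri_pt_weak z w v : FC z -> FC w -> FC v ->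
  tri_pt F z w -> tri_pt F z v \/ tri_pt F v w.
Proof.
move=> [P FP [a la ->]] [Q FQ [b lb ->]] [R FR [c lc ->]].
move=> /(tri_ptP FP FQ la lb) ab.
have [ac|nac] := EM (right_generic R (coords a) c); first by left; apply/tri_ptP.
right; apply/tri_ptP => //.
have fina := finite_coords a; have finb := finite_coords b.
have [d gd] := right_generic_exists C_monster A_small (F_so FR) fina.
have [s sa ab'] := right_generic_extend C_monster A_small (F_so FQ) d fina ab.
have gd' := right_generic_fix (F_so FR) sa gd.
have cd : olt R c (vact s d).
  have [//|cd|dc] := olt_total (F_so FR) lc (proj1 gd').
    by case: nac; rewrite cd.
  case: nac; exact: (right_generic_up C_monster A_small (F_so FR) fina gd' dc).
have bd : right_generic (opp_pair R) (coords b) (vact s d).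
  apply/(proj1 (proj1 (F_dno FR FQ) _ _ (proj1 gd') lb)).
  exact: right_generic_sub (@subsetUr _ _ _) ab'.
apply/(proj1 (proj1 (F_dno FR FQ) _ _ lc lb)).
exact: (right_generic_up C_monster A_small (so_pair_opp (F_so FR)) finb bd cd).
Qed.

Lemma tri_pt_dense : dense_on FC (tri_pt F).
Proof.
move=> _ _ [P FP [a la ->]] [Q FQ [b lb ->]] /(tri_ptP FP FQ la lb) ab.
have fina := finite_coords a.
have [c gc] := right_generic_exists C_monster A_small (F_so FP) fina.
have [s sa ab'] := right_generic_extend C_monster A_small (F_so FQ) c fina ab.
have gc' := right_generic_fix (F_so FP) sa gc; have lc' := proj1 gc'.
exists (pt (vact s c)); split.
- by exists P => //; exists (vact s c).
- exact/tri_ptP.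
- by apply/tri_ptP => //; exact: right_generic_sub (@subsetUr _ _ _) ab'.
Qed.

Lemma dep_tri z w : FC z -> FC w ->
  (dep_on A FC z w <-> ~ tri_pt F z w /\ ~ tri_pt F w z).
Proof.
move=> Fz Fw; move: (Fz) (Fw) => [P FP [a la ez]] [Q FQ [b lb ew]].
rewrite /dep_on ez ew (tri_ptP FP FQ la lb) (tri_ptP FQ FP lb la) /=.
have [h1 _] := proj1 (F_dno FP FQ) a b la lb.
split=> [[_ _ dep]|[nr nl]].
  split=> g; apply: dep; last first.
    exact: (indep_right_generic C_monster A_small (F_so FP) (finite_coords b) g).
  move/h1: g => g.
  exact: (indep_right_generic C_monster A_small (so_pair_opp (F_so FP)) (finite_coords b) g).
split; [by rewrite -ez|by rewrite -ew|].
apply: (dep_nongeneric C_monster A_small (F_so FP) (F_dno FP FP) la nl).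
by move=> /h1.
Qed.

Lemma tri_pt_aut s z w : fixes s A -> FC z -> FC w ->
  tri_pt F z w <-> tri_pt F (aut_point s z) (aut_point s w).
Proof.
move=> sA [P FP [a la ->]] [Q FQ [b lb ->]].
have lsa : locus P (vact s a) by exact/locus_aut.
have lsb : locus Q (vact s b) by exact/locus_aut.
have -> : aut_point s (pt a) = pt (vact s a) by [].
have -> : aut_point s (pt b) = pt (vact s b) by [].
rewrite (tri_ptP FP FQ la lb) (tri_ptP FP FQ lsa lsb); split=> g.
  by rewrite coords_vact; exact: (right_generic_aut (F_so FQ) sA g).
(* [homogeneity_pair] supplies an automorphism undoing [s] on these two tuples. *)
have [|t [tA ta tb]] := homogeneity_pair C_monster A_small
    (a := vact s a) (a' := a) (b := vact s b) (b' := b).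
  by move=> phi; rewrite -vact_vsum; exact: psat_aut.
by rewrite -ta -tb coords_vact; exact: (right_generic_aut (F_so FQ) tA g).
Qed.

(** * The linear order built from one selected pair per type *)

Variable rep : {x : fctx L & set (pform A x)} -> opair A.
Hypothesis rep_F : forall P, F P ->
  F (rep (type_of_pair P)) /\ type_of_pair (rep (type_of_pair P)) = type_of_pair P.

(** A type may occur in F with several orders; [rep] fixes the one that the linear order will
    extend. *)
Definition selected P : Prop := F P /\ rep (type_of_pair P) = P.

Definition type_of_point z : {x : fctx L & set (pform A x)} :=
  existT (fun x : fctx L => set (pform A x)) (projT1 z) (tp (projT2 z) A).

Definition rep_lt z w : Prop :=
  exists a b : tup C (octx (rep (type_of_point z))),
    [/\ z = pt a, w = pt b & olt (rep (type_of_point z)) a b].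

Lemma type_of_locus P (a : tup C (octx P)) :
  so_pair P -> locus P a -> type_of_point (pt a) = type_of_pair P.
Proof. by move=> soP la; rewrite /type_of_pair (locus_tp soP la). Qed.

Lemma rep_selected P : F P -> selected (rep (type_of_pair P)).
Proof. by move=> /rep_F[? e]; split=> //; rewrite e. Qed.

Lemma locus_pt_type P Q : type_of_pair P = type_of_pair Q -> locus_pt P = locus_pt Q.
Proof.
(* Writing the locus as a function of the packed type turns the equality of types into a plain
   congruence, without transport. *)
pose g (t : {x : fctx L & set (pform A x)}) : set (mpoint C) :=
  [set z | exists2 a : tup C (projT1 t), realizes (projT2 t) a & z = pt a].
exact: (congr1 g).
Qed.

Lemma restr_pair_type P Q R : type_of_pair P = type_of_pair Q ->
  restr_pair P R = restr_pair Q R.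
Proof.
pose g (t : {x : fctx L & set (pform A x)}) : opair A :=
  @Opair L C A (projT1 t) (projT2 t) (fun a b =>
    [/\ realizes (projT2 t) a, realizes (projT2 t) b & R (pt a) (pt b)]).
exact: (congr1 g).
Qed.

Lemma FC_selected z : FC z ->
  exists P (a : tup C (octx P)), [/\ selected P, locus P a & z = pt a].
Proof.
move=> [P FP]; have [_ /locus_pt_type <-] := rep_F FP => -[a la ->].
by exists (rep (type_of_pair P)), a; split=> //; exact: rep_selected.
Qed.

Lemma rep_lt_olt P (a b : tup C (octx P)) : selected P -> locus P a ->
  (rep_lt (pt a) (pt b) <-> olt P a b).
Proof.
move=> [FP rP] la; rewrite /rep_lt (type_of_locus (F_so FP) la) rP.
by split=> [[a' [b' [/pt_inj -> /pt_inj ->]]]|ab]; last by exists a, b.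
Qed.

Variable ltT : {x : fctx L & set (pform A x)} -> {x : fctx L & set (pform A x)} -> Prop.
Hypothesis ltT_lin : linear_order_on [set: {x : fctx L & set (pform A x)}] ltT.

Definition ext_lt : mpoint C -> mpoint C -> Prop :=
  refine (tri_pt F) type_of_point ltT rep_lt.

Lemma same_type_locus z t : FC z -> type_of_point z = t ->
  selected (rep t) /\ exists2 a, locus (rep t) a & z = pt a.
Proof.
move=> /FC_selected[P [a [sP la ->]]]; rewrite (type_of_locus (F_so (proj1 sP)) la).
by move=> <-; rewrite (proj2 sP); split=> //; exists a.
Qed.

Lemma ext_lt_linear : linear_order_on FC ext_lt.
Proof.
apply: refine_linear => //.
- exact: tri_pt_irr.
- exact: tri_pt_trans.
- exact: tri_pt_weak.
move=> t; split.
- move=> z [Fz zt]; have [sP [a la ->]] := same_type_locus Fz zt.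
  by rewrite rep_lt_olt //; exact: (olt_irr (F_so (proj1 sP))).
- move=> z w v [Fz zt] [Fw wt] [Fv vt].
  have [sP [a la ->]] := same_type_locus Fz zt.
  have [_ [b lb ->]] := same_type_locus Fw wt.
  have [_ [c lc ->]] := same_type_locus Fv vt.
  by rewrite !rep_lt_olt //; exact: (olt_trans (F_so (proj1 sP))).
- move=> z w [Fz zt] [Fw wt].
  have [sP [a la ->]] := same_type_locus Fz zt.
  have [_ [b lb ->]] := same_type_locus Fw wt.
  rewrite !rep_lt_olt // => ab.
  have [h|h|h] := olt_total (F_so (proj1 sP)) la lb; [by left| |by right].
  by case: ab; rewrite h.
Qed.

(** Right genericity over an element of the same locus implies being above it, so [olt P] already
    extends the relation refined there; the keys coincide and [ltT] is irreflexive, so ties are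
    settled by [olt P]. *)
Lemma ext_lt_olt P (a b : tup C (octx P)) : selected P -> locus P a -> locus P b ->
  (ext_lt (pt a) (pt b) <-> olt P a b).
Proof.
move=> sP la lb; have FP := proj1 sP; have soP := F_so FP.
have tri_olt (c d : tup C (octx P)) : locus P c -> locus P d ->
    tri_pt F (pt c) (pt d) -> olt P c d.
  move=> lc ld cd; have [//|e|dc] := olt_total soP lc ld.
    by case: (@tri_pt_irr (pt d)); [exists P => //; exists d|rewrite {1}e in cd *].
  move/(tri_ptP FP FP lc ld): cd => g.
  case: (right_generic_bound (B := coords c) soP _ lc dc).
  by rewrite setUid.
have [_ e] := sP; rewrite /ext_lt /refine !(type_of_locus soP) // rep_lt_olt //.
split=> [[/tri_olt|[_ [h|[]]]]|ab] //; first exact.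
  by have [irr _ _] := ltT_lin; case: (irr _ I h).
right; split; last by right.
by move=> /(tri_olt _ _ lb la) /(olt_trans soP ab); exact: olt_irr.
Qed.

Lemma ext_lt_aut s z w : fixes s A -> FC z -> FC w ->
  ext_lt z w <-> ext_lt (aut_point s z) (aut_point s w).
Proof.
move=> sA Fz Fw; rewrite /ext_lt /refine.
rewrite -(propext (tri_pt_aut sA Fz Fw)) -(propext (tri_pt_aut sA Fw Fz)).
have ty v : type_of_point (aut_point s v) = type_of_point v.
  by case: v => x v; rewrite /type_of_point /=; congr existT; exact: tp_aut.
rewrite !ty; suff E t : type_of_point z = t -> type_of_point w = t ->
    rep_lt z w <-> rep_lt (aut_point s z) (aut_point s w).
  by split=> -[h|[h1 [h|[e h]]]]; [left|right|right|left|right|right] => //;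
    split=> //; [left|right|left|right] => //; split=> //; apply/(E _ e).
move=> zt wt; have [sP [a la ->]] := same_type_locus Fz zt.
have [_ [b lb ->]] := same_type_locus Fw wt.
rewrite rep_lt_olt // -(olt_aut (F_so (proj1 sP)) _ _ sA).
have la' : locus (rep t) (vact s a) by exact/locus_aut.
exact: (iff_sym (rep_lt_olt (vact s b) sP la')).
Qed.

(** An equality of pairs, not just agreement on the locus, because [olt P] is empty outside it. *)
Lemma restr_pair_selected P : selected P -> restr_pair P ext_lt = P.
Proof.
move=> sP; have H a b : [/\ locus P a, locus P b & ext_lt (pt a) (pt b)] <-> olt P a b.
  split=> [[la lb]|ab]; first by rewrite ext_lt_olt.
  by have [la lb] := olt_locus (F_so (proj1 sP)) ab; split=> //; apply/ext_lt_olt.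
case: P sP H => x p lt _ H; rewrite /restr_pair; congr Opair.
by apply/funext => a; apply/funext => b; apply/propext/H.
Qed.

End Family.

Theorem theorem5
    (L : signature) (T : set (sentence L)) (C : structure L) (K : Type)
    (A : set (elem C)) (P0 : opair A) (F : set (opair A))
    (T_complete : complete_theory T)
    (C_monster : monster C T K)
    (A_small : small K A)
    (P0_so : so_pair P0) (P0_nonalg : non_algebraic P0)
    (F_class : F `<=` delta_class P0) :
  let FC := realizations F in
  let DF := dep_on A FC in
  let good (R : mpoint C -> mpoint C -> Prop) :=
    [/\ (* an A-invariant linear order on F(C) *)
        linear_order_on FC R /\ invariant_on A FC R,
        (* (i) *)
        strict_order_on FC (tri_pt F) /\
        (forall z w, FC z -> FC w -> tri_pt F z w -> R z w),
        (* (ii) *)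
        [/\ forall z w, FC z -> FC w ->
              (DF z w <-> ~ tri_pt F z w /\ ~ tri_pt F w z),
            equivalence_on FC DF,
            convex_relation_on FC R DF,
            linear_order_on (quotient FC DF) (quotient_lt R) &
            dense_on (quotient FC DF) (quotient_lt R)] &
        (* (iii) *)
        forall P, F P ->
        let P' := restr_pair P R in
        [/\ rel_definable (otype P') (olt P'),
            forall Q, F Q -> delta P' Q,
            forall a, locus P' a -> FC (pt a) &
            forall a b, locus P' a -> locus P' b ->
              [/\ right_generic P' (coords a) b <->
                    tri_pt F (pt a) (pt b),
                  olt P' a b <-> R (pt a) (pt b) &
                  dep_on A (locus_pt P') (pt a) (pt b) <->
                    DF (pt a) (pt b)]]]
  in
  (exists R, good R) /\
  (forall (I : Type) (P_ : I -> opair A),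
     (forall i, F (P_ i)) ->
     injective (fun i => type_of_pair (P_ i)) ->
     exists R, good R /\
       forall i a b, olt (P_ i) a b -> R (pt a) (pt b)).
Proof.
have F_so P : F P -> so_pair P by move=> /F_class[].
have F_dno P Q : F P -> F Q -> dno P Q.
  move=> FP FQ; have [_ _ dP] := F_class P FP; have [_ _ dQ] := F_class Q FQ.
  apply: (dno_trans C_monster A_small P0_so (F_so P FP) (F_so Q FQ)).
    exact: (delta_dno C_monster A_small dP).
  exact: (delta_dno C_monster A_small dQ).
move=> FC DF good.
have main (I : Type) (P_ : I -> opair A) : (forall i, F (P_ i)) ->
    injective (fun i => type_of_pair (P_ i)) ->
    exists R, good R /\ forall i a b, olt (P_ i) a b -> R (pt a) (pt b).
  move=> FP_ P_inj.
  have ex_rep t : exists Q : opair A,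
      (forall P, F P -> type_of_pair P = t -> F Q /\ type_of_pair Q = t) /\
      (forall i, type_of_pair (P_ i) = t -> Q = P_ i).
    have [[i <-]|noi] := EM (exists i, type_of_pair (P_ i) = t).
      by exists (P_ i); split=> // j /P_inj ->.
    have [[P [FP tP]]|noP] := EM (exists P, F P /\ type_of_pair P = t).
      by exists P; split=> // i hi; case: noi; exists i.
    (* [P0] is a default value for types that do not occur in F. *)
    exists P0; split=> [P FP tP|i hi]; first by case: noP; exists P.
    by case: noi; exists i.
  have [rep repP] := choice ex_rep.
  have rep_F P : F P ->
      F (rep (type_of_pair P)) /\ type_of_pair (rep (type_of_pair P)) = type_of_pair P.
    by move=> FP; exact: (proj1 (repP _) P FP erefl).
  have [ltT ltT_lin] := exists_linear_order {x : fctx L & set (pform A x)}.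
  pose R := ext_lt F rep ltT.
  have R_lin : linear_order_on FC R.
    exact: (ext_lt_linear C_monster A_small F_so F_dno rep_F ltT_lin).
  have irr := tri_pt_irr F_dno.
  have tr := tri_pt_trans C_monster A_small F_so F_dno.
  have weak := tri_pt_weak C_monster A_small F_so F_dno.
  have dep := dep_tri C_monster A_small F_so F_dno.
  have ext z w : FC z -> FC w -> tri_pt F z w -> R z w by left.
  exists R; split; last first.
    move=> i a b ab; have [la lb] := olt_locus (F_so _ (FP_ i)) ab.
    by apply/(ext_lt_olt F_so F_dno ltT_lin) => //; split=> //; exact: (proj2 (repP _)).
  split.
  - split=> // s sA z w Fz Fw.
    exact: (ext_lt_aut C_monster A_small F_so F_dno rep_F ltT sA Fz Fw).
  - by split.
  - split.
    + exact: dep.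
    + exact: (incomparability_equivalence irr weak dep).
    + exact: (incomparability_convex weak dep R_lin ext).
    + exact: (quotient_linear irr weak dep R_lin ext).
    + apply: (quotient_dense irr weak dep R_lin ext).
      exact: (tri_pt_dense C_monster A_small F_so F_dno).
  - move=> P FP P'; have sQ := rep_selected rep_F FP.
    (* The restricted pair is the selected pair of its type, hence a member of F, where definability
       and nonorthogonality are known. *)
    have -> : P' = rep (type_of_pair P).
      rewrite /P' (restr_pair_type _ (esym (proj2 (rep_F P FP)))).
      exact: (restr_pair_selected F_so F_dno ltT_lin).
    move: (rep _) sQ => Q sQ {P' FP P}; have FQ := proj1 sQ.
    have lFC a : locus Q a -> FC (pt a) by move=> la; exists Q => //; exists a.
    split=> //.
    + by case: (F_so Q FQ).
    + move=> Q' FQ'; have soQ := F_so Q FQ; have soQ' := F_so Q' FQ'.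
      exact: (dno_delta C_monster A_small soQ soQ' (F_dno _ _ FQ FQ')).
    + move=> a b la lb; split.
      * exact: iff_sym (tri_ptP F_dno FQ FQ la lb).
      * exact: iff_sym (ext_lt_olt F_so F_dno ltT_lin sQ la lb).
      * split=> -[_ _ d]; split=> //; [exact: lFC|exact: lFC| |];
          by [exists a|exists b].
split; last exact: main.
(* The first claim is the case of the empty family. *)
by have [||R [gR _]] := main void (fun v => match v with end); [case|case|exists R].
Qed.
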